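(* Let $k = \bar{k}$ be an algebraically closed field and let $A$ be a finite dimensional $k$-algebra. If $A$ is finitely controlled wild, then $A$ is not of amenable representation type.
   Context: For a $k$-algebra $B$, $\mathrm{mod}\, B$ denotes the category of finite dimensional $B$-modules. For a full subcategory $\mathcal{C}$ of $\mathrm{mod}\, A$, $\mathrm{Hom}_A(X,Y)_{\mathcal{C}}$ denotes the set of $A$-homomorphisms $X \to Y$ that factor through an object of $\mathcal{C}$; $\mathrm{rad}\,\mathrm{Hom}_A(X,Y)$ denotes the radical of the category $\mathrm{mod}\, A$ evaluated at $(X,Y)$, i.e. the set of $f\colon X \to Y$ such that $1_X - gf$ is invertible for every $g \colon Y \to X$; $\mathrm{add}(C)$ is the full subcategory of direct summands of finite direct sums of copies of $C$. Controlled wild: the algebra $A$ is controlled wild and controlled by $\mathcal{C}$ if there exist a faithful exact functor $F \colon \mathrm{mod}\, k\langle x,y\rangle \to \mathrm{mod}\, A$ (where $k\langle x,y\rangle$ is the free associative algebra on two generators) and a full subcategory $\mathcal{C}$ of $\mathrm{mod}\, A$, closed under direct sums and direct summands, such that for all $X, Y \in \mathrm{mod}\, k\langle x,y\rangle$, $$\mathrm{Hom}_A(F(X),F(Y)) = F\left(\mathrm{Hom}_{k\langle x,y\rangle}(X,Y)\right) \oplus \mathrm{Hom}_A(F(X),F(Y))_{\mathcal{C}}$$ and $$\mathrm{Hom}_A(F(X),F(Y))_{\mathcal{C}} \subseteq \mathrm{rad}\,\mathrm{Hom}_A(F(X),F(Y)).$$ $A$ is finitely controlled wild if it is controlled by $\mathrm{add}(C)$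 for some $C \in \mathrm{mod}\, A$. Amenability: a set $\mathcal{M}$ of finite dimensional $A$-modules is hyperfinite if for every $\varepsilon > 0$ there exists a number $L_\varepsilon > 0$ such that for every $M \in \mathcal{M}$ there exist a submodule $N \subseteq M$ with $\dim_k N \geq (1-\varepsilon)\dim_k M$ and finite dimensional $A$-modules $N_1,\dots,N_t$ with $\dim_k N_i \leq L_\varepsilon$ for all $i$, such that $N \cong \bigoplus_{i=1}^t N_i$. The algebra $A$ is of amenable representation type if the set of all finite dimensional $A$-modules (more precisely, a set meeting every isomorphism class) is hyperfinite. *)

(* Defs.v *)
From HB Require Import structures.
From mathcomp Require Import all_boot all_order all_algebra all_field.
From mathcomp Require Import finmap boolp reals monalg.

Set Implicit Arguments.
Unset Strict Implicit.
Unset Printing Implicit Defensive.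

Import Order.TTheory GRing.Theory Num.Theory.
Local Open Scope ring_scope.

(* k<x,y> is the monoid algebra of the free monoid on two letters.  The library
   only gives it a left algebra structure, whence the alias. *)
Definition free_algebra2 (k : fieldType) : Type := {malg k[{fmonom 'I_2}]}.

Section FreeAlgebra.
Variable k : fieldType.

HB.instance Definition _ := GRing.Lalgebra.on (free_algebra2 k).

Lemma free_algebra2_scaleAr (c : k) (u v : free_algebra2 k) :
  c *: (u * v) = u * (c *: v).
Proof.
apply/malgP => m; rewrite mcoeffZ mcoeffMl.
rewrite [RHS](mcoeffMlw _ (fsubset_refl (msupp (u : {malg _[_]})))
  (msuppZ_le c v)).
rewrite mulr_sumr; apply: eq_bigr => m1 _.
rewrite mulr_sumr; apply: eq_bigr => m2 _.
by rewrite mcoeffZ -mulrnAr mulrnAr mulrCA mulrnAr.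
Qed.

HB.instance Definition _ :=
  GRing.Lalgebra_isAlgebra.Build k (free_algebra2 k) free_algebra2_scaleAr.
End FreeAlgebra.

Section Modules.
Variables (k : fieldType) (B : algType k).

(* A finite dimensional left B-module: a finite dimensional k-vector space
   together with a representation of B on it. *)
Record fdModule := FdModule {
  fd_space :> vectType k;
  fd_act : B -> 'End(fd_space);
  fd_act_linear : linear fd_act;
  fd_act1 : fd_act 1 = \1%VF;
  fd_actM : forall a b, fd_act (a * b) = (fd_act a \o fd_act b)%VF
}.

HB.instance Definition _ (M : fdModule) :=
  GRing.isLinear.Build k B 'End(M) *:%R (@fd_act M) (@fd_act_linear M).

Definition fd_dim (M : fdModule) : nat := \dim {: M}.

Section Homs.
Variables M N : fdModule.

Definition equivariant : {pred 'Hom(M, N)} :=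
  [pred f : 'Hom(M, N) | `[< forall b x, f (fd_act M b x) = fd_act N b (f x) >]].

Lemma equivariantP (f : 'Hom(M, N)) :
  reflect (forall b x, f (fd_act M b x) = fd_act N b (f x)) (f \in equivariant).
Proof. exact: asboolP. Qed.

Lemma equivariant_submod_closed : submod_closed equivariant.
Proof.
split=> [|c f g /equivariantP Hf /equivariantP Hg]; apply/equivariantP => b x.
  by rewrite !lfunE linear0.
by rewrite !lfunE /= !lfunE /= Hf Hg linearD linearZ.
Qed.
HB.instance Definition _ :=
  GRing.isSubmodClosed.Build k 'Hom(M, N) equivariant equivariant_submod_closed.

Record modHom := ModHom {
  modHom_val :> 'Hom(M, N);
  modHom_valP : modHom_val \in equivariant
}.
HB.instance Definition _ := [isSub for modHom_val].
HB.instance Definition _ := [Choice of modHom by <:].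
HB.instance Definition _ := [SubChoice_isSubLmodule of modHom by <:].
End Homs.
Arguments equivariant M N : clear implicits.

Lemma modHom_id_subproof (M : fdModule) : \1%VF \in equivariant M M.
Proof. by apply/equivariantP => b x; rewrite !id_lfunE. Qed.
Definition modHom_id (M : fdModule) : modHom M M :=
  ModHom (modHom_id_subproof M).

Lemma modHom_comp_subproof (M N P : fdModule) (g : modHom N P) (f : modHom M N) :
  (g \o f)%VF \in equivariant M P.
Proof.
apply/equivariantP => b x; rewrite !comp_lfunE.
by rewrite (equivariantP _ (modHom_valP f)) (equivariantP _ (modHom_valP g)).
Qed.
Definition modHom_comp (M N P : fdModule) (g : modHom N P) (f : modHom M N) :
  modHom M P := ModHom (modHom_comp_subproof g f).

Definition mod_invertible (M N : fdModule) (f : modHom M N) : Prop :=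
  exists g : modHom N M,
    modHom_comp g f = modHom_id M /\ modHom_comp f g = modHom_id N.

Definition mod_iso (M N : fdModule) : Prop :=
  exists f : modHom M N, mod_invertible f.

Definition zero_act (b : B) : 'End('rV[k]_0) := 0.
Lemma zero_act_linear : linear zero_act.
Proof. by move=> c a b; rewrite /zero_act scaler0 addr0. Qed.
Lemma zero_act1 : zero_act 1 = \1%VF.
Proof. by apply/lfunP => x; apply/rowP => -[]. Qed.
Lemma zero_actM a b : zero_act (a * b) = (zero_act a \o zero_act b)%VF.
Proof. by apply/lfunP => x; apply/rowP => -[]. Qed.
Definition zero_module : fdModule :=
  FdModule zero_act_linear zero_act1 zero_actM.

Section DirectSum.
Variables M N : fdModule.

Definition dsum_fun (b : B) (u : M * N) : M * N :=
  (fd_act M b u.1, fd_act N b u.2).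
Lemma dsum_fun_linear b : linear (dsum_fun b).
Proof. by move=> c u v; rewrite /dsum_fun /= !linearP. Qed.
HB.instance Definition _ b :=
  GRing.isLinear.Build k (M * N)%type (M * N)%type *:%R (dsum_fun b)
    (dsum_fun_linear b).

Definition dsum_act (b : B) : 'End((M * N)%type) := linfun (dsum_fun b).
Lemma dsum_act_linear : linear dsum_act.
Proof.
move=> c a b; apply/lfunP => u; rewrite !lfunE /= !lfunE /= !lfunE /=.
by rewrite /dsum_fun !linearP /= !lfunE /= !lfunE.
Qed.
Lemma dsum_act1 : dsum_act 1 = \1%VF.
Proof.
by apply/lfunP => -[x y]; rewrite !lfunE /= /dsum_fun !fd_act1 !id_lfunE.
Qed.
Lemma dsum_actM a b : dsum_act (a * b) = (dsum_act a \o dsum_act b)%VF.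
Proof.
by apply/lfunP => u; rewrite comp_lfunE !lfunE /= /dsum_fun !fd_actM !comp_lfunE.
Qed.
Definition dsum : fdModule := FdModule dsum_act_linear dsum_act1 dsum_actM.
End DirectSum.

(* The direct sum of N_0, ..., N_(t-1); it is the zero module when t = 0. *)
Definition bigdsum (t : nat) (N : 'I_t -> fdModule) : fdModule :=
  \big[dsum/zero_module]_(i < t) N i.

Section Submodule.
Variables (M : fdModule) (U : {vspace M}).

Definition is_submodule : Prop :=
  forall b x, x \in U -> fd_act M b x \in U.

Hypothesis stableU : is_submodule.

Definition submodule_fun (b : B) (u : subvs_of U) : subvs_of U :=
  vsproj U (fd_act M b (vsval u)).
Lemma submodule_fun_linear b : linear (submodule_fun b).
Proof. by move=> c u v; rewrite /submodule_fun !linearP. Qed.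
HB.instance Definition _ b :=
  GRing.isLinear.Build k (subvs_of U) (subvs_of U) *:%R (submodule_fun b)
    (submodule_fun_linear b).

Definition submodule_act (b : B) : 'End(subvs_of U) := linfun (submodule_fun b).
Lemma submodule_actE b u : vsval (submodule_act b u) = fd_act M b (vsval u).
Proof. by rewrite lfunE /= vsprojK // stableU // subvsP. Qed.
Lemma submodule_act_linear : linear submodule_act.
Proof.
move=> c a b; apply/lfunP => u; apply/val_inj.
rewrite /= submodule_actE lfunE /= lfunE /= linearP /= !submodule_actE.
by rewrite lfunE /= lfunE.
Qed.
Lemma submodule_act1 : submodule_act 1 = \1%VF.
Proof.
by apply/lfunP => u; apply/val_inj; rewrite /= submodule_actE fd_act1 !id_lfunE.
Qed.
Lemma submodule_actM a b :
  submodule_act (a * b) = (submodule_act a \o submodule_act b)%VF.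
Proof.
apply/lfunP => u; apply/val_inj.
by rewrite /= comp_lfunE !submodule_actE fd_actM comp_lfunE.
Qed.
Definition submodule : fdModule :=
  FdModule submodule_act_linear submodule_act1 submodule_actM.
End Submodule.

Definition short_exact (M N P : fdModule) (f : modHom M N) (g : modHom N P) :
    Prop :=
  [/\ lker f = 0%VS, limg f = lker g & limg g = fullv].

(* Hom(M, N)_C, for the full subcategory with class of objects C. *)
Definition factors_through (C : fdModule -> Prop) (M N : fdModule)
    (f : modHom M N) : Prop :=
  exists (Z : fdModule) (g : modHom M Z) (h : modHom Z N),
    C Z /\ f = modHom_comp h g.

Definition in_radical (M N : fdModule) (f : modHom M N) : Prop :=
  forall g : modHom N M, mod_invertible (modHom_id M - modHom_comp g f).

Definition direct_summand (X Y : fdModule) : Prop :=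
  exists Z : fdModule, mod_iso (dsum X Z) Y.

Definition add_closure (C : fdModule) : fdModule -> Prop :=
  fun X => exists n : nat, direct_summand X (bigdsum (fun _ : 'I_n => C)).

Definition closed_under_sums (C : fdModule -> Prop) : Prop :=
  forall (t : nat) (X : 'I_t -> fdModule), (forall i, C (X i)) -> C (bigdsum X).

Definition closed_under_summands (C : fdModule -> Prop) : Prop :=
  forall X Y : fdModule, C Y -> direct_summand X Y -> C X.

Definition hyperfinite (R : realType) (S : fdModule -> Prop) : Prop :=
  forall eps : R, 0 < eps ->
  exists L : R, 0 < L /\
  forall M : fdModule, S M ->
  exists (U : {vspace M}) (stableU : is_submodule U),
    (1 - eps) * (fd_dim M)%:R <= (fd_dim (submodule stableU))%:R /\
    exists (t : nat) (N : 'I_t -> fdModule),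
      (forall i, (fd_dim (N i))%:R <= L) /\
      mod_iso (submodule stableU) (bigdsum N).

Definition amenable_type (R : realType) : Prop :=
  hyperfinite R (fun _ : fdModule => True).
End Modules.

(* An additive functor mod B -> mod B'; compatibility with scalars is not
   required. *)
Record modFunctor (k : fieldType) (B B' : algType k) := ModFunctor {
  fobj :> fdModule B -> fdModule B';
  fmap : forall M N : fdModule B, modHom M N -> modHom (fobj M) (fobj N);
  fmap_id : forall M, fmap (modHom_id M) = modHom_id (fobj M);
  fmap_comp : forall M N P (g : modHom N P) (f : modHom M N),
    fmap (modHom_comp g f) = modHom_comp (fmap g) (fmap f);
  fmap_add : forall M N (f g : modHom M N), fmap (f + g) = fmap f + fmap g
}.

Definition faithful (k : fieldType) (B B' : algType k) (F : modFunctor B B') : Prop :=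
  forall M N : fdModule B, injective (@fmap _ _ _ F M N).

Definition exact_functor (k : fieldType) (B B' : algType k)
    (F : modFunctor B B') : Prop :=
  forall (M N P : fdModule B) (f : modHom M N) (g : modHom N P),
    short_exact f g -> short_exact (fmap F f) (fmap F g).

Section ControlledWild.
Variables (k : fieldType) (A : falgType k).

(* The first two clauses of the last conjunct say that Hom(F X, F Y) is the
   internal direct sum of F(Hom(X, Y)) and Hom(F X, F Y)_C. *)
Definition controlled_by (C : fdModule A -> Prop) : Prop :=
  [/\ closed_under_sums C, closed_under_summands C &
   exists F : modFunctor (free_algebra2 k) A,
   [/\ faithful F, exact_functor F &
    forall X Y : fdModule (free_algebra2 k),
    [/\ forall h : modHom (F X) (F Y),
          exists (f : modHom X Y) (g : modHom (F X) (F Y)),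
          factors_through C g /\ h = fmap F f + g,
        forall f : modHom X Y, factors_through C (fmap F f) -> fmap F f = 0 &
        forall g : modHom (F X) (F Y), factors_through C g -> in_radical g]]].

Definition finitely_controlled_wild : Prop :=
  exists C : fdModule A, controlled_by (add_closure C).
End ControlledWild.

(* Main.v *)
From HB Require Import structures.
Require Import Defs.
From mathcomp Require Import all_boot all_order perm all_algebra all_field.
From mathcomp Require Import finmap boolp reals monalg zify.

Set Implicit Arguments.
Unset Strict Implicit.
Unset Printing Implicit Defensive.

Import Order.TTheory GRing.Theory Num.Theory.
Local Open Scope ring_scope.

(* Representations of the star quiver with 8 arms are k<x,y>-modules: x acts by
   distinct scalars at the vertices and y is the sum of the arrows.  Let P be the
   projective cover of the centre and S_e the simple module at the end of arm e,
   so that Hom(P, M) and Hom(S_e, M) are the vertex spaces of M.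

   For X = P or S_e and Y in mod A put I_X(Y) = Hom(F X, Y) / Hom(F X, Y)_C; then
   I_X(F M) is Hom(X, M) up to an automorphism of k.  Maps F X -> C are finitely
   generated over End C, so if N = N_1 + ... + N_t is a direct sum inside F M with
   codimension u, the map from the direct sum of the I_X(N_i) to I_X(F M) has
   kernel and cokernel of dimension O(u).  Hyperfiniteness of the modules F M thus
   covers almost all of the star M by almost independent substars of bounded size.

   This fails for the star with centre k^(2s), arms k^s, and e-th arrow mapping a
   polynomial of degree < 2s to its values at g^(es), ..., g^(es+s-1).  By the
   subspace design bound of Guruswami and Kopparty (divisibility of the
   q-Wronskian of a basis), a subspace W of the centre of dimension at most s/3
   has images in the arms of total dimension at least 5 dim W, whereas the whole
   centre has dimension 2s and the arms only 8s = 4 (2s). *)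

(** * Subspace designs from q-Wronskians *)


Lemma prod_top_coef (k : fieldType) (I : Type) (s : seq I) (F : I -> {poly k})
    (d : I -> nat) :
  (forall i, size (F i) <= (d i).+1)%N ->
  (size (\prod_(i <- s) F i)%R <= (\sum_(i <- s) d i).+1)%N /\
  (\prod_(i <- s) F i)`_(\sum_(i <- s) d i) = \prod_(i <- s) (F i)`_(d i).
Proof.
move=> Fd; elim: s => [|i s [IHs IHc]].
  by rewrite !big_nil size_poly1 coef1.
rewrite !big_cons; split.
  apply: leq_trans (size_polyMleq _ _) _.
  have := leq_add (Fd i) IHs; rewrite addSn addnS.
  by case: (_ + _)%N => // n; rewrite !ltnS.
rewrite coefM (bigD1 (inord (d i))) //= inordK ?ltnS ?leq_addr //.
rewrite addKn IHc [X in _ + X]big1 ?addr0 // => j ne_ji.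
have {ne_ji} : (j != d i :> nat).
  apply: contraNneq ne_ji => ji; apply/eqP/val_inj.
  by rewrite /= inordK ?ltnS ?leq_addr.
rewrite neq_ltn => /orP[lt_ji | lt_ij].
  rewrite [X in _ * X]nth_default ?mulr0 //.
  by apply: leq_trans IHs _; rewrite ltn_subRL ltn_add2r.
by rewrite nth_default ?mul0r //; apply: leq_trans (Fd i) _.
Qed.

(** Each Leibniz term takes one entry from every row, so the row bounds [d i] add up and the
    coefficient at their sum is computed entrywise. *)
Lemma det_top_coef (k : fieldType) r (G : 'M[{poly k}]_r) (d : 'I_r -> nat) :
  (forall i j, size (G i j) <= (d i).+1)%N ->
  (size (\det G) <= (\sum_i d i).+1)%N /\
  (\det G)`_(\sum_i d i) = \det (\matrix_(i, j) (G i j)`_(d i)).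
Proof.
move=> Gd; have top (s : 'S_r) := prod_top_coef (index_enum 'I_r)
  (F := fun i => G i (s i)) (fun i => Gd i (s i)).
split.
  apply: leq_trans (size_sum _ _ _) _; apply/bigmax_leqP => s _.
  by rewrite mulr_sign; case: ifP => _; rewrite ?size_polyN (top s).1.
rewrite coef_sum; apply: eq_bigr => s _.
rewrite !mulr_sign; case: ifP => _; rewrite ?coefN (top s).2;
  by [congr (- _); apply: eq_bigr => i _; rewrite mxE |
      apply: eq_bigr => i _; rewrite mxE].
Qed.

Section QWronskian.
Variables (k : fieldType) (g : k).

(** Row [i] of [R] lists the coefficients of a polynomial f_i of degree < N; the product of [R] with
    this matrix has the entries f_i(g^j X). *)
Definition qshift N r : 'M[{poly k}]_(N, r) :=
  \matrix_(a, j) (g ^+ (j * a) *: 'X^a).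

Definition qwronskian r N (R : 'M[k]_(r, N)) : {poly k} :=
  \det (map_mx polyC R *m qshift N r).

Lemma qshiftE r N (R : 'M[k]_(r, N)) p i j :
  (map_mx polyC R *m qshift N p) i j =
  \sum_a (R i a * g ^+ (j * a)) *: 'X^a.
Proof. by rewrite mxE; apply: eq_bigr => a _; rewrite !mxE mul_polyC scalerA. Qed.

Lemma coef_qshift r N (R : 'M[k]_(r, N)) p i j a :
  ((map_mx polyC R *m qshift N p) i j)`_a =
  (rVpoly (row i R))`_a * g ^+ (j * a).
Proof.
rewrite qshiftE coef_sum; have [aN | Na] := ltnP a N; last first.
  rewrite nth_default ?mul0r ?(leq_trans (size_poly _ _)) // big1 // => b _.
  by rewrite coefZ coefXn gtn_eqF ?mulr0 // (leq_trans (ltn_ord b)).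
rewrite (coef_rVpoly_ord _ (Ordinal aN)) mxE (bigD1 (Ordinal aN)) //=.
rewrite coefZ coefXn eqxx mulr1 big1 ?addr0 // => b ne_ba.
by rewrite coefZ coefXn eq_sym -val_eqE /= in ne_ba *; rewrite (negbTE ne_ba) mulr0.
Qed.

Lemma qwronskianM r N (P : 'M[k]_r) (R : 'M[k]_(r, N)) :
  qwronskian (P *m R) = (\det P)%:P * qwronskian R.
Proof. by rewrite /qwronskian map_mxM -mulmxA det_mulmx det_map_mx. Qed.

Lemma size_qwronskian r N (R : 'M[k]_(r, N)) :
  (size (qwronskian R) <= (r * N.-1).+1)%N.
Proof.
have [|sz _] := @det_top_coef _ r (map_mx polyC R *m qshift N r) (fun=> N.-1).
  move=> i j; rewrite qshiftE; apply: leq_trans (size_sum _ _ _) _.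
  apply/bigmax_leqP => a _; apply: leq_trans (size_scale_leq _ _) _.
  by rewrite size_polyXn; case: N R a => [|N] _ [a].
by move: sz; rewrite sum_nat_const card_ord.
Qed.

Section Degree.
Variables (N : nat).
Hypothesis g_inj : {in [pred a | a < N]%N &, injective (GRing.exp g)}.

Let deg r (R : 'M[k]_(r, N)) i := (size (rVpoly (row i R))).-1.

Let row_neq0 r (R : 'M[k]_(r, N)) i : row_free R -> rVpoly (row i R) != 0.
Proof.
move=> Rfree; apply/eqP => f0.
have : row i R = 0 by rewrite -[row i R]rVpolyK f0 linear0.
rewrite rowE => /(congr1 (mulmx^~ (pinvmx R))).
rewrite -mulmxA mulmxVp // mul0mx mulmx1 => /matrixP/(_ 0 i).
by rewrite !mxE !eqxx => /eqP; rewrite oner_eq0.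
Qed.

(** The coefficient at the sum of the degrees is the product of the leading coefficients and a
    Vandermonde determinant in the powers [g ^+ deg R i], which are distinct because the degrees
    are. *)
Let qwronskian_deg_inj r (R : 'M[k]_(r, N)) :
  row_free R -> injective (deg R) -> qwronskian R != 0.
Proof.
move=> Rfree deg_inj.
have size_row i : size (rVpoly (row i R)) = (deg R i).+1.
  by rewrite prednK // size_poly_gt0 row_neq0.
have [i j|_ top] := @det_top_coef _ r (map_mx polyC R *m qshift N r) (deg R).
  apply/leq_sizeP => a lt_da; rewrite coef_qshift nth_default ?mul0r //.
  by rewrite size_row.
apply: contraTneq isT => W0; move: top; rewrite -/(qwronskian R) W0 coef0.
set T := \matrix_(i, j) _.
have -> : T = diag_mx (\row_i lead_coef (rVpoly (row i R))) *m
              (Vandermonde r (\row_i g ^+ deg R i))^T.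
  apply/matrixP => i j; rewrite mul_diag_mx [LHS]mxE [RHS]mxE coef_qshift !mxE.
  by rewrite lead_coefE -exprM mulnC.
rewrite det_mulmx det_diag det_tr det_Vandermonde => /esym/eqP.
rewrite mulf_eq0 => /orP[]/eqP/eqP/prodf_eq0[i _].
  by rewrite mxE lead_coef_eq0 (negbTE (row_neq0 _ Rfree)).
case/prodf_eq0 => j lt_ij; rewrite !mxE subr_eq0 => /eqP/g_inj.
have degN l : deg R l \in [pred a | a < N]%N.
  by rewrite inE -ltnS -size_row ltnS size_poly.
by move=> /(_ (degN _) (degN _))/deg_inj ji; rewrite ji ltnn in lt_ij.
Qed.

(** Induction on the sum of the degrees: if two rows have equal degree, an invertible row operation
    cancels one leading term. This lowers the sum and changes the q-Wronskian only by a scalar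
    factor. *)
Lemma qwronskian_neq0 r (R : 'M[k]_(r, N)) : row_free R -> qwronskian R != 0.
Proof.
have [n] := ubnP (\sum_i deg R i)%N; elim: n R => // n IHn R le_Rn Rfree.
have [/injectiveP|/injectivePn[i [j ne_ij deg_ij]]] := boolP (injectiveb (deg R)).
  exact: qwronskian_deg_inj.
pose c := lead_coef (rVpoly (row i R)) / lead_coef (rVpoly (row j R)).
pose P : 'M[k]_r := 1%:M - c *: delta_mx i j.
have Punit : P \in unitmx.
  have: P *m (1%:M + c *: delta_mx i j) = 1%:M.
    rewrite mulmxDr mulmx1 mulmxBl mul1mx -scalemxAl -scalemxAr mul_delta_mx_0 1?eq_sym //.
    by rewrite !scaler0 subr0 subrK.
  by case/mulmx1_unit.
have PR l : row l (P *m R) = row l R - (if l == i then c else 0) *: row j R.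
  rewrite mulmxBl mul1mx linearB /= -scalemxAl linearZ /= !rowE mulmxA.
  congr (_ - _); rewrite mul_delta_mx_cond -!rowE eq_sym; case: eqP => _.
  by rewrite mulr1n -rowE.
  by rewrite mulr0n mul0mx scaler0 scale0r.
have PRfree : row_free (P *m R).
  by rewrite /row_free (eqmxMfull R _) ?row_full_unit.
suff: qwronskian (P *m R) != 0.
  by apply: contraNneq => W0; rewrite qwronskianM W0 mulr0.
have size_PR : (0 < size (rVpoly (row i (P *m R))))%N.
  by rewrite size_poly_gt0 row_neq0.
apply: IHn PRfree; rewrite -ltnS; apply: leq_trans le_Rn; rewrite ltnS.
rewrite (bigD1 i) // [X in (_ < X)%N](bigD1 i) //=.
have -> : (\sum_(l | l != i) deg (P *m R) l = \sum_(l | l != i) deg R l)%N.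
  by apply: eq_bigr => l /negbTE li; rewrite /deg PR li scale0r subr0.
rewrite ltn_add2r -ltnS /deg (prednK size_PR).
rewrite prednK ?size_poly_gt0 ?row_neq0 // PR eqxx linearB linearZ /=.
have size_i : (0 < size (rVpoly (row i R)))%N by rewrite size_poly_gt0 row_neq0.
have size_j : size (rVpoly (row j R)) = size (rVpoly (row i R)).
  rewrite -(prednK size_i) -[X in X.+1]/(deg R i) deg_ij prednK //.
  by rewrite size_poly_gt0 row_neq0.
rewrite -(prednK size_i) ltnS; apply/leq_sizeP => a.
rewrite leq_eqVlt => /orP[/eqP <-|lt_a]; rewrite coefB coefZ.
  rewrite /c !lead_coefE size_j divfK ?subrr //.
  by rewrite -size_j -lead_coefE lead_coef_eq0 row_neq0.
by rewrite !nth_default ?size_j ?mulr0 ?subr0 // -(prednK size_i).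
Qed.
End Degree.

(** * Zeros of the q-Wronskian and the design bound *)

Section Design.
Variables (N d s : nat).
Hypothesis g_inj : {in [pred a | a < maxn N (d * s)]%N &, injective (GRing.exp g)}.

(** Sends the coefficients of f to f(g^(es)), ..., f(g^(es+s-1)). The points of an arm are
    consecutive powers of [g], so the substitution of gX for X moves along the arm. *)
Definition eval_arm (e : 'I_d) : 'M[k]_(N, s) :=
  \matrix_(a, j) g ^+ ((e * s + j) * a).

Lemma eval_armE r (R : 'M[k]_(r, N)) e i j :
  (R *m eval_arm e) i j = (rVpoly (row i R)).[g ^+ (e * s + j)].
Proof.
rewrite mxE (@horner_coef_wide _ N) ?size_poly //; apply: eq_bigr => a _.
by rewrite coef_rVpoly_ord !mxE exprM.
Qed.

(** After an invertible row operation, r minus the rank of the polynomials vanish on the whole arm.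
    Since l + r <= s, the points z g^j with j < r all lie in the arm, so each of these rows of the
    q-Wronskian matrix vanishes at z and contributes a factor X - z. *)
Lemma arm_zero_dvd r (R : 'M[k]_(r, N)) (e : 'I_d) l : (l + r <= s)%N ->
  ('X - (g ^+ (e * s + l))%:P) ^+ (r - \rank (R *m eval_arm e)) %|
    qwronskian R.
Proof.
move=> lrs; set A := R *m _; set z := g ^+ _; pose P := invmx (col_ebase A).
have Punit : P \in unitmx by rewrite unitmx_inv col_ebase_unit.
have R0 (i : 'I_r) j : (\rank A <= i)%N -> (P *m R *m eval_arm e) i j = 0.
  move=> le_i; rewrite -mulmxA -/A -{1}(mulmx_ebase A) -mulmxA mulKmx ?col_ebase_unit //.
  rewrite mxE big1 // => b _; rewrite !mxE [X in _ && X]ltnNge le_i andbF mul0r //.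
suff: ('X - z%:P) ^+ (r - \rank A) %| qwronskian (P *m R).
  rewrite qwronskianM mul_polyC dvdpZr //.
  by move: Punit; rewrite unitmxE unitfE.
pose q (i : 'I_r) := if (\rank A <= i)%N then 'X - z%:P else 1.
set G := map_mx polyC (P *m R) *m qshift N r.
have q_dvd i j : q i %| G i j.
  rewrite /q; case: ifP => [le_i|_]; last exact: dvd1p.
  have ljs : (l + j < s)%N by rewrite (leq_trans _ lrs) // ltn_add2l.
  rewrite dvdp_XsubCl rootE -(R0 i (Ordinal ljs) le_i) eval_armE /= /G.
  rewrite qshiftE horner_sum (@horner_coef_wide _ N) ?size_poly //; apply/eqP.
  apply: eq_bigr => a _; rewrite hornerZ hornerXn coef_rVpoly_ord /z.
  rewrite [row _ _ _ _]mxE -!exprM -mulrA -exprD -mulnDl.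
  by rewrite [(j + _)%N]addnC -addnA.
have -> : qwronskian (P *m R) = \prod_i q i * \det (\matrix_(i, j) (G i j %/ q i)).
  have -> : \prod_i q i = \det (diag_mx (\row_i q i)).
    by rewrite det_diag; apply: eq_bigr => i _; rewrite mxE.
  rewrite -det_mulmx; congr (\det _); apply/matrixP => i j.
  rewrite mul_diag_mx [RHS]mxE [(\row__ _) _ _]mxE [(\matrix_(_, _) _) _ _]mxE mulrC.
  by rewrite divpK ?q_dvd.
apply: dvdp_mulr; rewrite -big_mkcond /=.
by rewrite -(@big_geq_mkord _ _ _ _ _ xpredT (fun=> 'X - z%:P)) prodr_const_nat.
Qed.

Lemma dvdp_prod_coprime (I : eqType) (t : seq I) (F : I -> {poly k}) p :
    uniq t -> {in t &, forall i j, i != j -> coprimep (F i) (F j)} ->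
  {in t, forall i, F i %| p} -> \prod_(i <- t) F i %| p.
Proof.
elim: t => [|i t IHt] /=; first by rewrite big_nil dvd1p.
case/andP => it ut co_t dvd_t; rewrite big_cons Gauss_dvdp; last first.
  rewrite big_seq; apply: (big_ind (fun q => coprimep (F i) q)).
  - exact: coprimep1.
  - by move=> u v; rewrite coprimepMr => -> ->.
  move=> j jt; apply: co_t; rewrite ?inE ?eqxx ?jt ?orbT //.
  by apply: contraNneq it => ->.
rewrite dvd_t ?inE ?eqxx // IHt // => [a b at_ bt|a at_].
  by apply: co_t; rewrite inE ?at_ ?bt orbT.
by apply: dvd_t; rewrite inE at_ orbT.
Qed.

(** Each arm has s - r + 1 points with r successors inside the arm, and each of them is a zero of
    multiplicity at least the rank defect. The zeros cannot exceed the degree of the nonzero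
    q-Wronskian. *)
Lemma subspace_design r (R : 'M[k]_(r, N)) : row_free R -> (r <= s)%N ->
  ((s - r).+1 * \sum_e (r - \rank (R *m eval_arm e)) <= r * N.-1)%N.
Proof.
move=> Rfree rs; pose c e := (r - \rank (R *m eval_arm e))%N.
pose F (p : 'I_d * 'I_(s - r).+1) := ('X - (g ^+ (p.1 * s + p.2))%:P) ^+ c p.1.
have W0 : qwronskian R != 0.
  apply: qwronskian_neq0 Rfree => a b; rewrite !inE => aN bN.
  by apply: g_inj; rewrite inE leq_max ?aN ?bN.
have lt_s (l : 'I_(s - r).+1) : (0 < r)%N -> (l < s)%N.
  move=> r0; apply: leq_ltn_trans (leq_ord l) _.
  by rewrite ltn_subrL r0 (leq_trans r0).
have /dvdp_leq : \prod_p F p %| qwronskian R.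
  apply: dvdp_prod_coprime (index_enum_uniq _) _ _ => [p q _ _ ne_pq|p _].
    (* For r = 0 the index may reach s, the first point of the next arm, so points can coincide; but
       then all exponents are zero. *)
    have [r0|r_gt0] := posnP r.
      have := leq_subr (\rank (R *m eval_arm p.1)) r.
      rewrite -/(c p.1) [X in (_ <= X)%N]r0 leqn0 /F => /eqP->.
      by rewrite expr0 coprime1p.
    apply: coprimep_expl; apply: coprimep_expr; apply: coprimep_XsubC2.
    rewrite subr_eq0; apply: contraNneq ne_pq => /g_inj.
    have lt_ds (u : 'I_d * 'I_(s - r).+1) :
        (u.1 * s + u.2)%N \in [pred a | a < maxn N (d * s)]%N.
      rewrite inE leq_max; apply/orP; right.
      apply: (@leq_trans (u.1.+1 * s)); last by rewrite leq_mul2r ltn_ord orbT.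
      by rewrite mulSn addnC ltn_add2r lt_s.
    move=> /(_ (lt_ds _) (lt_ds _)) eq_qp.
    have s_gt0 := leq_trans r_gt0 rs.
    rewrite -pair_eqE /=; apply/andP; split; apply/eqP/val_inj => /=.
      have := congr1 (divn^~ s) eq_qp.
      by rewrite !divnMDl // !divn_small ?lt_s ?addn0.
    have := congr1 (modn^~ s) eq_qp.
    by rewrite !modnMDl !modn_small ?lt_s.
  by apply: arm_zero_dvd; rewrite addnC -leq_subRL // -ltnS.
move=> /(_ W0); have -> : size (\prod_p F p) = ((s - r).+1 * \sum_e c e).+1.
  rewrite size_prod; last by move=> p _; rewrite expf_neq0 ?polyXsubC_eq0.
  under eq_bigr => p _ do rewrite size_exp_XsubC -addn1.
  rewrite big_split /= sum1_card -addSn addnK; congr _.+1.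
  rewrite big_distrr -(pair_big_dep predT (fun=> predT) (fun e _ => c e)) /=.
  by apply: eq_bigr => e _; rewrite sum_nat_const card_ord.
by move=> le; rewrite -ltnS; apply: leq_trans le (size_qwronskian R).
Qed.
End Design.
End QWronskian.

(** * Linear algebra and biproducts *)


Section Vspace.
Variables (k : fieldType) (vT : vectType k).

(** A subspace of maximal dimension inside [P] is all of [P]. This gives the equivariant maps a
    dimension. *)
Lemma submod_closed_vspace (P : {pred vT}) :
  submod_closed P -> exists U : {vspace vT}, U =i P.
Proof.
case=> P0 Plin; pose D n := `[< exists U : {vspace vT}, {subset U <= P} /\ \dim U = n >].
have exD : exists n, D n.
  exists 0%N; apply/asboolP; exists 0%VS; rewrite dimv0; split=> // v.
  by rewrite memv0 => /eqP->.
have leD n : D n -> (n <= dim vT)%N.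
  by move=> /asboolP[U [_ <-]]; rewrite -dimvf dimvS ?subvf.
case: (ex_maxnP exD leD) => n /asboolP[U [UP dimU]] maxU.
exists U => v; apply/idP/idP=> [|Pv]; first exact: UP.
apply: contraTT isT => Uv; have /maxU : D n.+1.
  apply/asboolP; exists (U + <[v]>)%VS; split.
    move=> w /memv_addP[u Uu [_ /vlineP[c ->] ->]].
    by rewrite addrC; apply: Plin Pv (UP _ Uu).
  have v0 : v != 0 by apply: contraNneq Uv => ->; rewrite mem0v.
  rewrite dimv_disjoint_sum ?dimU ?dim_vline ?v0 ?addn1 //.
  apply/eqP; rewrite -subv0; apply/subvP => w /memv_capP[Uw /vlineP[c wv]].
  rewrite memv0 wv; apply/eqP; move: Uw; rewrite wv; case: (eqVneq c 0) => [->|c0].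
    by rewrite scale0r.
  by move/(memvZ c^-1); rewrite scalerK // (negbTE Uv).
by rewrite ltnn.
Qed.

(** Here and below the complement [T :\: K] stands for the image of [T] in the quotient by [K];
    vectors independent modulo [K] stay independent when projected to it. *)
Lemma leq_dim_diffv (T K : {vspace vT}) r (v : 'I_r -> vT) :
    (forall i, v i \in T) ->
    (forall c : 'I_r -> k, \sum_i c i *: v i \in K -> forall i, c i = 0) ->
  (r <= \dim (T :\: K))%N.
Proof.
move=> vT' indep.
have split_v i : exists w, w \in (T :\: K)%VS /\ v i - w \in K.
  have: v i \in (T :\: K + K)%VS by rewrite addv_diff memvE (subv_trans _ (addvSl _ _)) // -memvE.
  by case/memv_addP => w Tw [u Ku ->]; exists w; rewrite addrC addKr.
pose w i := projT1 (cid (split_v i)).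
have wP i : w i \in (T :\: K)%VS /\ v i - w i \in K by exact: projT2 (cid (split_v i)).
pose X := [tuple w i | i < r].
have Xi (i : 'I_r) : X`_i = w i by rewrite -tnth_nth tnth_mktuple.
have /eqP freeX : free X.
  apply/freeP => c Xc; apply: indep.
  have -> : \sum_i c i *: v i = \sum_i c i *: (v i - w i).
    apply/eqP; rewrite -subr_eq0 -sumrB -[X in _ == X]Xc; apply/eqP.
    by apply: eq_bigr => i _; rewrite -scalerBr opprB addrC subrK Xi.
  by apply: memv_suml => i _; rewrite memvZ // (wP i).2.
rewrite -[r](size_tuple X) -freeX dimvS //; apply/span_subvP => _ /tnthP[i ->].
by rewrite tnth_mktuple (wP i).1.
Qed.

(** A complement of [S] in [H] adds at most its own dimension under each [f a]. In the application
    the [f a] are the precompositions with a basis of Hom(M, C), whose number does not depend on the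
    target. *)
Lemma leq_dim_sum_limg (vT' : vectType k) m (f : 'I_m -> 'Hom(vT, vT'))
    (H S : {vspace vT}) : (S <= H)%VS ->
  (\dim (\sum_a (f a @: H)) <= \dim (\sum_a (f a @: S)) + m * (\dim H - \dim S))%N.
Proof.
move=> SH; have dimD : \dim (H :\: S) = (\dim H - \dim S)%N.
  by rewrite -(dimv_cap_compl H S) (capv_idPr SH) addKn.
have -> : (\sum_a (f a @: H) = \sum_a (f a @: S) + \sum_a (f a @: (H :\: S)))%VS.
  rewrite -big_split /=; apply: eq_bigr => a _.
  by rewrite -limgD addvC addv_diff (addv_idPl SH).
apply: leq_trans (leq_of_leqif (dimv_add_leqif _ _)) _; rewrite leq_add2l.
apply: leq_trans (dimv_leq_sum _ _ _) _; rewrite -[X in (X * _)%N]card_ord -sum_nat_const -dimD.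
by apply: leq_sum => a _; rewrite -(limg_ker_dim (f a) (H :\: S)) leq_addl.
Qed.
End Vspace.

Section LinearFunctions.
Variables (k : fieldType) (U V W : vectType k).

Section LfunOf.
Variables (f : U -> V) (flin : linear f).
HB.instance Definition _ := GRing.isLinear.Build k U V *:%R f flin.
Lemma linfunE x : linfun f x = f x. Proof. exact: lfunE. Qed.
End LfunOf.

Fact precomp_linear (g : 'Hom(U, V)) : linear (fun h : 'Hom(V, W) => (h \o g)%VF).
Proof. by move=> c h h'; rewrite comp_lfunDl comp_lfunZl. Qed.

Fact postcomp_linear (h : 'Hom(V, W)) : linear (fun g : 'Hom(U, V) => (h \o g)%VF).
Proof. by move=> c g g'; rewrite comp_lfunDr comp_lfunZr. Qed.
End LinearFunctions.

Definition precomp (k : fieldType) (U V W : vectType k) (g : 'Hom(U, V)) :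
  'Hom('Hom(V, W), 'Hom(U, W)) :=
  linfun (fun h : 'Hom(V, W) => (h \o g)%VF).
Definition postcomp (k : fieldType) (U V W : vectType k) (h : 'Hom(V, W)) :
  'Hom('Hom(U, V), 'Hom(U, W)) :=
  linfun (fun g : 'Hom(U, V) => (h \o g)%VF).
Lemma precompE (k : fieldType) (U V W : vectType k) (g : 'Hom(U, V)) (h : 'Hom(V, W)) :
  @precomp k U V W g h = (h \o g)%VF.
Proof. exact: (linfunE (@precomp_linear k U V W g)). Qed.
Lemma postcompE (k : fieldType) (U V W : vectType k) (g : 'Hom(U, V)) (h : 'Hom(V, W)) :
  @postcomp k U V W h g = (h \o g)%VF.
Proof. exact: (linfunE (@postcomp_linear k U V W h)). Qed.

Section Biproducts.
Variables (k : fieldType) (B : algType k).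
Implicit Types M N D Y : fdModule B.

Lemma modHomE M N (f g : modHom M N) : (forall x, f x = g x) -> f = g.
Proof. by move=> fg; apply: val_inj; apply/lfunP. Qed.

Lemma modHom_compE M N P (g : modHom N P) (f : modHom M N) x :
  modHom_comp g f x = g (f x).
Proof. by rewrite /= comp_lfunE. Qed.

Lemma modHom_actE M N (f : modHom M N) b x : f (fd_act M b x) = fd_act N b (f x).
Proof. by have /equivariantP := modHom_valP f. Qed.

Lemma modHom_idE M x : modHom_id M x = x.
Proof. by rewrite /= id_lfunE. Qed.

Definition mkModHom M N (f : 'Hom(M, N))
    (Hf : forall b x, f (fd_act M b x) = fd_act N b (f x)) : modHom M N :=
  ModHom (introT (equivariantP f) Hf).

Definition biproduct t (N : 'I_t -> fdModule B) D : Prop :=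
  exists (inj : forall i, modHom (N i) D) (prj : forall i, modHom D (N i)),
  [/\ forall i x, prj i (inj i x) = x,
      forall i j x, i != j -> prj j (inj i x) = 0 &
      forall x, x = \sum_i inj i (prj i x)].

(** The types [T i] vary with [i], so the values are transported along the equation given by
    [unliftP]; irrelevance of equality proofs on ordinals then removes the casts. *)
Lemma ord_recl_fun t (T : 'I_t.+1 -> Type) (x0 : T ord0)
    (x : forall i, T (lift ord0 i)) :
  {f : forall i, T i | f ord0 = x0 /\ forall i, f (lift ord0 i) = x i}.
Proof.
exists (fun i => match unliftP ord0 i with
  | UnliftSome j e => ecast i (T i) (esym e) (x j)
  | UnliftNone e => ecast i (T i) (esym e) x0
  end); split=> [|i].
  case: (unliftP ord0 ord0) => [j e|e]; last by rewrite (eq_irrelevance e erefl).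
  by case/eqP: (neq_lift ord0 j).
case: (unliftP ord0 (lift ord0 i)) => [j e|e].
  by have ij := lift_inj e; case: _ / ij e => e; rewrite (eq_irrelevance e erefl).
by case/eqP: (neq_lift ord0 i); rewrite e.
Qed.

Section Dsum.
Variables M N : fdModule B.
Fact dsum_inl_linear : linear (fun x : M => (x, 0) : dsum M N).
Proof. by move=> c x y; congr pair; rewrite /= ?scaler0 ?addr0. Qed.
Fact dsum_inr_linear : linear (fun x : N => (0, x) : dsum M N).
Proof. by move=> c x y; congr pair; rewrite /= ?scaler0 ?addr0. Qed.
Fact dsum_fst_linear : linear (fun u : dsum M N => u.1).
Proof. by []. Qed.
Fact dsum_snd_linear : linear (fun u : dsum M N => u.2).
Proof. by []. Qed.

Lemma dsum_actE b u : fd_act (dsum M N) b u = (fd_act M b u.1, fd_act N b u.2).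
Proof. by rewrite lfunE. Qed.

Lemma dsum_biproduct : exists (i1 : modHom M (dsum M N)) (i2 : modHom N (dsum M N))
  (p1 : modHom (dsum M N) M) (p2 : modHom (dsum M N) N),
  [/\ forall x, i1 x = (x, 0), forall x, i2 x = (0, x),
      forall u, p1 u = u.1 & forall u, p2 u = u.2].
Proof.
unshelve eexists; [apply: (@mkModHom _ _ (linfun (fun x : M => (x, 0) : dsum M N)))|].
  by move=> b x; rewrite !(linfunE dsum_inl_linear) dsum_actE /= linear0.
unshelve eexists; [apply: (@mkModHom _ _ (linfun (fun x : N => (0, x) : dsum M N)))|].
  by move=> b x; rewrite !(linfunE dsum_inr_linear) dsum_actE /= linear0.
unshelve eexists; [apply: (@mkModHom _ _ (linfun (fun u : dsum M N => u.1)))|].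
  by move=> b x; rewrite !(linfunE dsum_fst_linear) dsum_actE /=.
unshelve eexists; [apply: (@mkModHom _ _ (linfun (fun u : dsum M N => u.2)))|].
  by move=> b x; rewrite !(linfunE dsum_snd_linear) dsum_actE /=.
split=> x; [exact: (linfunE dsum_inl_linear) | exact: (linfunE dsum_inr_linear)
  | exact: (linfunE dsum_fst_linear) | exact: (linfunE dsum_snd_linear)].
Qed.
End Dsum.

Lemma bigdsum_biproduct t (N : 'I_t -> fdModule B) : biproduct N (bigdsum N).
Proof.
elim: t N => [|t IHt] N; rewrite /bigdsum.
  rewrite big_ord0; exists (fun i : 'I_0 => False_rect _ (notF (ltn_ord i))).
  exists (fun i : 'I_0 => False_rect _ (notF (ltn_ord i))).
  by split=> [[]|[]|x] //; rewrite big_ord0; apply/rowP => -[].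
rewrite big_ord_recl.
have := IHt (fun i => N (lift ord0 i)); rewrite /bigdsum.
move: (\big[_/_]_(i < t) _) => D [inj [prj [ij ij0 sumD]]].
have [i1 [i2 [p1 [p2 [i1E i2E p1E p2E]]]]] := dsum_biproduct (N ord0) D.
have [inj' [inj0 injS]] := ord_recl_fun (T := fun i => modHom (N i) (dsum (N ord0) D))
  i1 (fun i => modHom_comp i2 (inj i)).
have [prj' [prj0 prjS]] := ord_recl_fun (T := fun i => modHom (dsum (N ord0) D) (N i))
  p1 (fun i => modHom_comp (prj i) p2).
exists inj', prj'; split=> [i x|i j x|x].
- case: (unliftP ord0 i) x => [j ->|->] x; last by rewrite inj0 prj0 p1E i1E.
  by rewrite injS prjS !modHom_compE p2E i2E ij.
- case: (unliftP ord0 i) x => [i' ->|->] x; case: (unliftP ord0 j) => [j' ->|->].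
  + rewrite (inj_eq lift_inj) injS prjS !modHom_compE p2E i2E; exact: ij0.
  + by rewrite injS prj0 modHom_compE p1E i2E.
  + by rewrite inj0 prjS modHom_compE p2E i1E linear0.
  + by rewrite eqxx.
rewrite big_ord_recl inj0 prj0 p1E i1E.
under eq_bigr => i _ do rewrite injS prjS !modHom_compE p2E.
rewrite -linear_sum -sumD /= i2E; case: x => x y; congr pair => /=.
  by rewrite addr0.
by rewrite add0r.
Qed.
End Biproducts.

(** * Maps factoring through add C *)


Section HomSpaces.
Variables (k : fieldType) (B : algType k).
Implicit Types M N C Y : fdModule B.

Definition homs M N : {vspace 'Hom(M, N)} :=
  projT1 (cid (submod_closed_vspace (@equivariant_submod_closed k B M N))).

Lemma mem_homs M N f : (f \in homs M N) = (f \in @equivariant k B M N).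
Proof. exact: projT2 (cid (submod_closed_vspace (@equivariant_submod_closed k B M N))) f. Qed.

Lemma modHom_homs M N (f : modHom M N) : (f : 'Hom(M, N)) \in homs M N.
Proof. by rewrite mem_homs modHom_valP. Qed.

Lemma homs_modHom M N f : f \in homs M N -> exists g : modHom M N, g = f :> 'Hom(M, N).
Proof. by rewrite mem_homs => Hf; exists (ModHom Hf). Qed.

(** With b_a a basis of Hom(M, C), every map through a power of C is a sum of maps h_a b_a. The
    number of summands is bounded independently of [N]. *)
Definition through C M N : {vspace 'Hom(M, N)} :=
  (\sum_(a < \dim (homs M C)) (precomp N (vbasis (homs M C))`_a @: homs C N))%VS.

Lemma comp_through C M N (g : modHom M C) (h : modHom C N) :
  (h \o g)%VF \in through C M N.
Proof.
rewrite (coord_vbasis (modHom_homs g)) -postcompE linear_sum /=.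
apply: memv_sumr => a _; rewrite postcompE -comp_lfunZr memvZ //.
by rewrite -precompE memv_img // modHom_homs.
Qed.

Lemma throughP C M N f : f \in through C M N ->
  exists h : 'I_(\dim (homs M C)) -> modHom C N,
    f = \sum_a (h a \o (vbasis (homs M C))`_a)%VF.
Proof.
case/memv_sumP => h hH ->.
have ex a : exists h' : modHom C N, h a = (h' \o (vbasis (homs M C))`_a)%VF.
  have /memv_imgP[u /homs_modHom[h' <-] ->] := hH a isT.
  by exists h'; rewrite precompE.
exists (fun a => projT1 (cid (ex a))); apply: eq_bigr => a _.
exact: projT2 (cid (ex a)).
Qed.

Lemma through_homs C M N : (through C M N <= homs M N)%VS.
Proof.
apply/subv_sumP => a _; apply/subvP => _ /memv_imgP[h /homs_modHom[h' <-] ->].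
rewrite precompE.
have /homs_modHom[g <-] : (vbasis (homs M C))`_a \in homs M C.
  by apply/vbasis_mem/mem_nth; rewrite size_tuple.
exact: (modHom_homs (modHom_comp h' g)).
Qed.

(** The identity of C^n is a sum of maps through C, which gives one direction; conversely a sum over
    the basis of Hom(M, C) factors through C^m with m the dimension of Hom(M, C). *)
Lemma factors_through_add C M N (f : modHom M N) :
  factors_through (add_closure C) f <-> (f : 'Hom(M, N)) \in through C M N.
Proof.
split.
  case=> Z [g [h [[n [Z' [phi [psi [psiK _]]]]] ->]]].
  have [i1 [_ [p1 [_ [i1E _ p1E _]]]]] := dsum_biproduct Z Z'.
  have [inj [prj [_ _ sumD]]] := bigdsum_biproduct (fun _ : 'I_n => C).
  have psiK' x : psi (phi x) = x by rewrite -modHom_compE psiK modHom_idE.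
  have -> : modHom_comp h g = \sum_i
      (modHom_comp h (modHom_comp p1 (modHom_comp psi (inj i))) \o
       modHom_comp (prj i) (modHom_comp phi (modHom_comp i1 g)))%VF :> 'Hom(M, N).
    apply/lfunP => x; rewrite sum_lfunE modHom_compE.
    under eq_bigr => i _ do rewrite comp_lfunE !modHom_compE.
    by rewrite -!linear_sum -sumD /= psiK' p1E i1E.
  by apply: memv_suml => i _; apply: comp_through.
move/throughP; set m := \dim _ => -[h fE].
have [inj [prj [ij ij0 _]]] := bigdsum_biproduct (fun _ : 'I_m => C).
have ex (a : 'I_m) : exists g : modHom M C, g = (vbasis (homs M C))`_a :> 'Hom(M, C).
  by apply/homs_modHom/vbasis_mem/mem_nth; rewrite size_tuple.
pose g a := projT1 (cid (ex a)).
have gE a : g a = (vbasis (homs M C))`_a :> 'Hom(M, C) by exact: projT2 (cid (ex a)).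
set Z := bigdsum _ in inj prj ij ij0.
have [|G GE] := @homs_modHom M Z (\sum_a (inj a \o g a)%VF).
  by apply: memv_suml => a _; exact: (modHom_homs (modHom_comp (inj a) (g a))).
have [|H HE] := @homs_modHom Z N (\sum_a (h a \o prj a)%VF).
  by apply: memv_suml => a _; exact: (modHom_homs (modHom_comp (h a) (prj a))).
exists Z, G, H; split.
  exists m, (zero_module B).
  have [i1 [_ [p1 [_ [i1E _ p1E _]]]]] := dsum_biproduct Z (zero_module B).
  exists p1, i1; split; apply: modHomE => x; rewrite modHom_compE modHom_idE.
    by rewrite i1E p1E; case: x => x y; congr pair; apply/rowP => -[].
  by rewrite p1E i1E.
apply: modHomE => x; rewrite modHom_compE HE GE fE !sum_lfunE.
apply: eq_bigr => a _; rewrite !comp_lfunE linear_sum /= (bigD1 a) //= big1.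
  by rewrite comp_lfunE ij addr0 gE.
by move=> b ne_ba; rewrite comp_lfunE ij0.
Qed.

(** * Homomorphisms into a decomposed submodule *)

Section Decomposition.
Variables (Y : fdModule B) (U : {vspace Y}) (stableU : is_submodule U).
Variables (t : nat) (N : 'I_t -> fdModule B).
Variables (J : forall i, modHom (N i) Y).
Variables (P : forall i, modHom (submodule stableU) (N i)).
Hypothesis JP : forall u, vsval u = \sum_i J i (P i u).
Hypothesis J_indep : forall x : (forall i, N i), \sum_i J i (x i) = 0 -> forall i, x i = 0.

(** The copy of Hom(M, N_i) in Hom(M, Y); its complement to [through C M Y] measures what N_i
    contributes to the quotient of Hom(M, Y). *)
Definition part M i : {vspace 'Hom(M, Y)} := (postcomp M (J i) @: homs M (N i))%VS.

Lemma part_homs M i : (part M i <= homs M Y)%VS.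
Proof.
apply/subvP => _ /memv_imgP[h /homs_modHom[h' <-] ->]; rewrite postcompE.
exact: (modHom_homs (modHom_comp (J i) h')).
Qed.

(** A map with values in [U] is the sum of its components in the N_i. What remains is detected by
    composing with a projection to a complement of [U]. *)
Lemma dim_homs_part M : (\dim (homs M Y) <=
  \dim (\sum_i part M i) + fd_dim M * (fd_dim Y - \dim U))%N.
Proof.
(* This projection is only k-linear, so its composites are counted among all linear maps from [M] to
   the complement. *)
pose F : 'Hom(Y, subvs_of U^C) := (linfun (vsproj U^C) \o (\1 - projv U))%VF.
rewrite -(limg_ker_dim (postcomp M F) (homs M Y)); apply: leq_add.
  apply: dimvS; apply/subvP => f /memv_capP[/homs_modHom[f' <-]]; move: f' => {}f.
  rewrite memv_ker postcompE => /eqP Ff0.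
  have fU x : f x \in U.
    have /lfunP/(_ x) := Ff0; rewrite !comp_lfunE zero_lfunE lfunE /= => /(congr1 vsval).
    rewrite linear0 vsprojK; last first.
      by rewrite add_lfunE opp_lfunE id_lfunE memv_projC.
    rewrite add_lfunE opp_lfunE id_lfunE => /eqP; rewrite subr_eq0 => /eqP->.
    exact: memv_proj.
  have [|f' f'E] := @homs_modHom M (submodule stableU) (linfun (vsproj U) \o f)%VF.
    rewrite mem_homs; apply/equivariantP => b x; apply: subvs_inj.
    rewrite submodule_actE // !comp_lfunE !lfunE /= !vsprojK ?fU //.
    exact: modHom_actE.
  have -> : f = \sum_i (J i \o modHom_comp (P i) f')%VF :> 'Hom(M, Y).
    apply/lfunP => x; rewrite sum_lfunE.
    under eq_bigr => i _ do rewrite comp_lfunE modHom_compE.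
    by rewrite -JP f'E comp_lfunE lfunE /= vsprojK.
  apply: memv_sumr => i _; rewrite -postcompE memv_img //; exact: modHom_homs.
apply: leq_trans (dimvS (subvf _)) _; rewrite dimvf.
have -> : dim 'Hom(M, subvs_of U^C) = (fd_dim M * \dim U^C)%N.
  by rewrite /fd_dim !dimvf.
by rewrite dimv_compl.
Qed.

Lemma part_indep M : directv (\sum_i part M i).
Proof.
apply/directv_sum_independent => f fP f0 i _.
have ex j : exists h : modHom M (N j), f j = (J j \o h)%VF.
  have /memv_imgP[u /homs_modHom[h <-] ->] := fP j isT.
  by exists h; rewrite postcompE.
pose h j := projT1 (cid (ex j)).
have hE j : f j = (J j \o h j)%VF by exact: projT2 (cid (ex j)).
apply/lfunP => x; rewrite hE zero_lfunE comp_lfunE.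
rewrite (J_indep (x := fun j => h j x)) ?linear0 //.
have /lfunP/(_ x) := f0; rewrite zero_lfunE sum_lfunE => {2}<-.
by apply: eq_bigr => j _; rewrite hE comp_lfunE.
Qed.

(** Cokernel estimate: by [dim_homs_part] the parts miss only O(u) dimensions of Hom(M, Y), where u
    is the codimension of [U], hence no more modulo the maps through C. *)
Lemma dim_homs_through C M : (\dim (homs M Y) - \dim (through C M Y) <=
  \sum_i \dim (part M i :\: through C M Y) +
  fd_dim M * (fd_dim Y - \dim U))%N.
Proof.
set K := through C M Y; rewrite leq_subLR addnA.
apply: leq_trans (dim_homs_part M) _; rewrite leq_add2r.
have /dimvS : (\sum_i part M i <= K + \sum_i (part M i :\: K))%VS.
  apply/subv_sumP => i _; apply: subv_trans (addvSl _ K) _.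
  by rewrite -addv_diff addvC addvS // (sumv_sup i).
move/leq_trans; apply; apply: leq_trans (leq_of_leqif (dimv_add_leqif _ _)) _.
by rewrite leq_add2l dimv_leq_sum.
Qed.

(** Kernel estimate: the parts are independent, so dimensions can be lost modulo K only inside K.
    Nearly all of K comes from maps M -> C -> N_i, because the parts nearly fill Hom(C, Y); the
    defect is multiplied by the number of basis maps from M to C. *)
Lemma sum_dim_part C M :
  (\sum_i \dim (part M i :\: through C M Y) + \dim (through C M Y) <=
   \dim (homs M Y) + \dim (homs M C) * (fd_dim C * (fd_dim Y - \dim U)))%N.
Proof.
set K := through C M Y; pose S := (\sum_i part C i)%VS.
pose g a := precomp Y (vbasis (homs M C))`_a.
(* The maps M -> C -> N_i -> Y, which lie both in [part M i] and in [K]. *)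
pose KU i : {vspace 'Hom(M, Y)} := (\sum_(a < \dim (homs M C)) (g a @: part C i))%VS.
have S_homs : (S <= homs C Y)%VS by apply/subv_sumP => i _; apply: part_homs.
have KU_K i : (KU i <= K)%VS.
  by apply/subv_sumP => a _; rewrite (sumv_sup a) // limgS ?part_homs.
have KU_part i : (KU i <= part M i)%VS.
  apply/subv_sumP => a _; apply/subvP => _ /memv_imgP[_ /memv_imgP[h /homs_modHom[h' <-] ->] ->].
  rewrite precompE postcompE.
  have /homs_modHom[g' <-] : (vbasis (homs M C))`_a \in homs M C.
    by apply/vbasis_mem/mem_nth; rewrite size_tuple.
  rewrite -comp_lfunA -postcompE memv_img //; exact: (modHom_homs (modHom_comp h' g')).
have le_i i : (\dim (part M i :\: K) + \dim (KU i) <= \dim (part M i))%N.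
  by rewrite -(dimv_cap_compl (part M i) K) addnC leq_add2r dimvS // subv_cap KU_part KU_K.
have le_K : (\dim K <= \dim (\sum_i KU i) + \dim (homs M C) * (fd_dim C * (fd_dim Y - \dim U)))%N.
  apply: leq_trans (leq_dim_sum_limg (fun a : 'I__ => g a) S_homs) _.
  have -> : (\sum_(a < \dim (homs M C)) (g a @: S) = \sum_i KU i)%VS.
    rewrite exchange_big /=; apply: eq_bigr => a _; exact: limg_sum.
  by rewrite leq_add2l leq_mul2l leq_subLR dim_homs_part orbT.
apply: leq_trans (leq_add (leqnn _) le_K) _; rewrite addnA leq_add2r.
apply: leq_trans (_ : \dim (\sum_i part M i) <= _)%N; last first.
  by apply: dimvS; apply/subv_sumP => i _; apply: part_homs.
rewrite (eqP (part_indep M)) /=.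
apply: leq_trans (leq_add (leqnn _) (dimv_leq_sum _ _ _)) _.
by rewrite -big_split /=; apply: leq_sum.
Qed.
End Decomposition.

Lemma submodule_decomposition (Y : fdModule B) (U : {vspace Y}) (stableU : is_submodule U)
    t (N : 'I_t -> fdModule B) :
  mod_iso (submodule stableU) (bigdsum N) ->
  exists (J : forall i, modHom (N i) Y) (P : forall i, modHom (submodule stableU) (N i)),
    (forall u, vsval u = \sum_i J i (P i u)) /\
    (forall x : (forall i, N i), \sum_i J i (x i) = 0 -> forall i, x i = 0).
Proof.
case=> phi [psi [psiK phiK]].
have [inj [prj [ij ij0 sumD]]] := bigdsum_biproduct N.
have [|incl inclE] := @homs_modHom (submodule stableU) Y (linfun vsval).
  rewrite mem_homs; apply/equivariantP => b x.
  by rewrite [LHS]lfunE [in RHS]lfunE /= submodule_actE.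
have inclE' x : incl x = vsval x by rewrite inclE lfunE.
have psiK' x : psi (phi x) = x by rewrite -modHom_compE psiK modHom_idE.
have phiK' x : phi (psi x) = x by rewrite -modHom_compE phiK modHom_idE.
exists (fun i => modHom_comp incl (modHom_comp psi (inj i))).
exists (fun i => modHom_comp (prj i) phi); split=> [u|x].
  under eq_bigr => i _ do rewrite !modHom_compE.
  by rewrite -!linear_sum -sumD /= psiK' inclE'.
under eq_bigr => i _ do rewrite !modHom_compE.
rewrite -!linear_sum /= inclE' => S0.
have /(congr1 phi) := subvs_inj (etrans S0 (esym (linear0 (@vsval _ _ U)))); rewrite phiK' linear0 => sum0 i.
have /(congr1 (prj i)) := sum0; rewrite linear0 linear_sum (bigD1 i) //= ij big1 ?addr0 //.
by move=> j ne_ji; rewrite ij0.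
Qed.
End HomSpaces.

(** * Star representations as modules over the free algebra *)


Section XYModules.
Variable k : fieldType.

Section Act.
Variables (V : vectType k) (x y : 'End(V)).

Definition letter (i : 'I_2) : 'End(V) := if i == ord0 then x else y.

Definition word (m : seq 'I_2) : 'End(V) :=
  foldr (fun i f => (letter i \o f)%VF) \1%VF m.

Lemma word_cat m m' : word (m ++ m') = (word m \o word m')%VF.
Proof. by elim: m => [|i m IHm] /=; rewrite ?comp_lfun1l // IHm comp_lfunA. Qed.

Definition xy_act (a : free_algebra2 k) : 'End(V) :=
  \sum_(m <- msupp (a : {malg k[{fmonom 'I_2}]}))
     (a : {malg k[{fmonom 'I_2}]})@_m *: word m.

(** Allows two elements to share one index set of monomials, as additivity of the action
    requires. *)
Lemma xy_actEw (D : {fset {fmonom 'I_2}}) (a : free_algebra2 k) :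
  (msupp (a : {malg k[{fmonom 'I_2}]}) `<=` D)%fset ->
  xy_act a = \sum_(m <- D) (a : {malg k[{fmonom 'I_2}]})@_m *: word m.
Proof.
move=> le; rewrite [LHS](big_fset_incl _ le) => //= m mD /mcoeff_outdom ->.
by rewrite scale0r.
Qed.

Lemma xy_act_linear : linear xy_act.
Proof.
move=> c a b; pose D : {fset {fmonom 'I_2}} := (msupp (a : {malg k[{fmonom 'I_2}]})
  `|` msupp (b : {malg k[{fmonom 'I_2}]}))%fset.
rewrite (@xy_actEw D a) ?fsubsetUl // (@xy_actEw D b) ?fsubsetUr //.
rewrite (@xy_actEw D (c *: a + b)); last first.
  apply: fsubset_trans (msuppD_le _ _) _; apply: fsetSU; exact: msuppZ_le.
rewrite scaler_sumr -big_split /=; apply: eq_bigr => m _.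
by rewrite mcoeffD mcoeffZ scalerDl scalerA.
Qed.
HB.instance Definition _ :=
  GRing.isLinear.Build k (free_algebra2 k) 'End(V) *:%R xy_act xy_act_linear.

Lemma xy_actU c m : xy_act << c *g m >> = c *: word m.
Proof. by rewrite (xy_actEw msuppU_le) big_seq_fset1 mcoeffUU. Qed.

Lemma xy_actE a v : xy_act a v =
  \sum_(m <- msupp (a : {malg k[{fmonom 'I_2}]}))
     (a : {malg k[{fmonom 'I_2}]})@_m *: word m v.
Proof. by rewrite sum_lfunE; apply: eq_bigr => m _; rewrite scale_lfunE. Qed.

Lemma xy_act1 : xy_act 1 = \1%VF.
Proof. by rewrite [LHS]xy_actU scale1r fm1. Qed.

Lemma xy_actM a b : xy_act (a * b) = (xy_act a \o xy_act b)%VF.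
Proof.
apply/lfunP => v; rewrite malgME linear_sum /= sum_lfunE comp_lfunE.
rewrite [RHS]xy_actE; apply: eq_bigr => m _.
rewrite linear_sum sum_lfunE [xy_act b v]xy_actE linear_sum scaler_sumr.
apply: eq_bigr => m' _; rewrite /= xy_actU fmM word_cat !scale_lfunE comp_lfunE.
by rewrite linearZ scalerA.
Qed.

Definition xy_module : fdModule (free_algebra2 k) :=
  FdModule xy_act_linear xy_act1 xy_actM.

Definition generator (i : 'I_2) : free_algebra2 k := << 1 *g fmu i >>.

Lemma xy_act_generator i : xy_act (generator i) = letter i.
Proof. by rewrite xy_actU scale1r fmU /= comp_lfun1r. Qed.
End Act.

Lemma xy_hom_act (V V' : vectType k) (x y : 'End(V)) (x' y' : 'End(V'))
    (f : modHom (xy_module x y) (xy_module x' y')) v :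
  f (x v) = x' (f v) /\ f (y v) = y' (f v).
Proof.
have act i : f (letter x y i v) = letter x' y' i (f v).
  by rewrite -!xy_act_generator; exact: (modHom_actE f (generator i) v).
by split; [have := act ord0 | have := act ord_max].
Qed.

Lemma xy_homE (V V' : vectType k) (x y : 'End(V)) (x' y' : 'End(V')) (f : 'Hom(V, V')) :
  (forall v, f (x v) = x' (f v)) -> (forall v, f (y v) = y' (f v)) ->
  exists g : modHom (xy_module x y) (xy_module x' y'), g = f :> 'Hom(V, V').
Proof.
move=> fx fy; have fword m v : f (word x y m v) = word x' y' m (f v).
  elim: m v => [|i m IHm] v /=; first by rewrite !id_lfunE.
  by rewrite !comp_lfunE -IHm /letter; case: ifP.
have fP : f \in @equivariant k _ (xy_module x y) (xy_module x' y').
  apply/equivariantP => b v; rewrite /= !xy_actE linear_sum.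
  by apply: eq_bigr => m _; rewrite linearZ /= fword.
by exists (ModHom fP).
Qed.
End XYModules.

Lemma modHom_linE (k : fieldType) (B : algType k) (M N : fdModule B)
    a (f g : modHom M N) x : (a *: f + g) x = a *: f x + g x.
Proof. by rewrite /= add_lfunE scale_lfunE. Qed.

(** A decomposition of the identity of [M] into maps through the [X p], which every additive functor
    preserves. *)
Definition splits_into (k : fieldType) (B : algType k) (I : finType)
    (X : I -> fdModule B) (M : fdModule B) : Prop :=
  exists (i : forall p, modHom (X p) M) (q : forall p, modHom M (X p)),
    forall x, x = \sum_p i p (q p x).

(** Through such coordinates the row space of a matrix represents a subspace of Hom(X, M). *)
Definition hom_coordinates (k : fieldType) (B : algType k) (X M : fdModule B) n
    (theta : 'rV[k]_n -> modHom X M) : Prop :=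
  [/\ linear theta, injective theta & forall f, exists w, f = theta w].

Section Star.
Variables (k : fieldType) (d : nat) (lam0 : k) (lam : 'I_d -> k).
Hypothesis lam_neq0 : forall e, lam e != lam0.
Hypothesis lam_inj : injective lam.

Definition simple (c : k) : fdModule (free_algebra2 k) :=
  @xy_module k 'rV[k]_1 (c *: \1%VF) 0.

Section StarModule.
Variables (N s : nat) (E : 'I_d -> 'M[k]_(N, s)).

Definition star_x (u : 'rV[k]_N * 'M[k]_(d, s)) : 'rV[k]_N * 'M[k]_(d, s) :=
  (lam0 *: u.1, \matrix_(e, j) (lam e * u.2 e j)).
Definition star_y (u : 'rV[k]_N * 'M[k]_(d, s)) : 'rV[k]_N * 'M[k]_(d, s) :=
  (0, \matrix_(e, j) (u.1 *m E e) 0 j).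

Fact star_x_linear : linear star_x.
Proof.
move=> c u v; congr pair; first by rewrite /= scalerDr !scalerA mulrC.
by apply/matrixP => e j; rewrite !mxE mulrDr mulrCA.
Qed.
Fact star_y_linear : linear star_y.
Proof.
move=> c u v; congr pair; first by rewrite /= scaler0 addr0.
by apply/matrixP => e j; rewrite [LHS]mxE /= mulmxDl -scalemxAl !mxE.
Qed.

Definition star : fdModule (free_algebra2 k) :=
  @xy_module k ('rV[k]_N * 'M[k]_(d, s))%type (linfun star_x) (linfun star_y).

Definition arm_fun (e : 'I_d) (w : 'rV[k]_s) (c : 'rV[k]_1) : 'rV[k]_N * 'M[k]_(d, s) :=
  (0, \matrix_(e', j) ((e' == e)%:R * (c *m w) 0 j)).
Fact arm_fun_linear e w : linear (arm_fun e w).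
Proof.
move=> a c c'; congr pair; first by rewrite /= scaler0 addr0.
by apply/matrixP => i j; rewrite [LHS]mxE /= mulmxDl -scalemxAl !mxE mulrDr mulrCA.
Qed.

Lemma arm_hom_subproof e w : exists g : modHom (simple (lam e)) star,
  g = linfun (arm_fun e w) :> 'Hom('rV[k]_1, _).
Proof.
apply: xy_homE => c; rewrite ?scale_lfunE ?id_lfunE ?zero_lfunE.
  rewrite linearZ /= (linfunE (arm_fun_linear e w)) (linfunE star_x_linear).
  congr pair; first by rewrite /= !scaler0.
  by apply/matrixP => i j; rewrite !mxE; case: eqP => [->|_]; rewrite ?mul0r ?mulr0.
rewrite linear0 (linfunE star_y_linear) (linfunE (arm_fun_linear e w)).
by congr pair; apply/matrixP => i j; rewrite [RHS]mxE /= mul0mx !mxE.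
Qed.
Definition arm_hom e w := projT1 (cid (arm_hom_subproof e w)).
Lemma arm_homE e w c : arm_hom e w c = arm_fun e w c.
Proof.
rewrite /arm_hom; case: cid => g /= ->; exact: (linfunE (arm_fun_linear e w)).
Qed.
End StarModule.

(** The projective cover P of the centre as a representation of the star: all arrows leave the
    centre, so it is one-dimensional at every vertex. *)
Definition star1 : fdModule (free_algebra2 k) := @star 1 1 (fun=> 1%:M).

Section CenterHom.
Variables (N s : nat) (E : 'I_d -> 'M[k]_(N, s)).

Definition center_fun (w : 'rV[k]_N) (u : 'rV[k]_1 * 'M[k]_(d, 1)) :
    'rV[k]_N * 'M[k]_(d, s) :=
  (u.1 *m w, \matrix_(e, j) (u.2 e 0 * (w *m E e) 0 j)).
Fact center_fun_linear w : linear (center_fun w).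
Proof.
move=> a u v; congr pair; first by rewrite /= mulmxDl -scalemxAl.
by apply/matrixP => i j; rewrite !mxE mulrDl mulrA.
Qed.

Lemma center_hom_subproof w : exists g : modHom star1 (star E),
  g = linfun (center_fun w) :> 'Hom('rV[k]_1 * 'M[k]_(d, 1), _)%type.
Proof.
apply: xy_homE => u; rewrite !(linfunE (center_fun_linear w)).
  rewrite !(linfunE (@star_x_linear _ _)); congr pair; first by rewrite /= -scalemxAl.
  by apply/matrixP => i j; rewrite !mxE mulrA.
rewrite !(linfunE (@star_y_linear _ _ _)); congr pair; first by rewrite /= mul0mx.
apply/matrixP => i j; rewrite [LHS]mxE [RHS]mxE /= [X in X * _]mxE mulmx1 -mulmxA.
by rewrite [RHS]mxE big_ord1.
Qed.
Definition center_hom w := projT1 (cid (center_hom_subproof w)).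
Lemma center_homE w u : center_hom w u = center_fun w u.
Proof.
rewrite /center_hom; case: cid => g /= ->; exact: (linfunE (center_fun_linear w)).
Qed.

(** Precomposition with the inclusion of S_e in P is the e-th arrow in coordinates. This expresses
    the arrow by a morphism, to which a functor can be applied. *)
Lemma center_hom_arm w e :
  modHom_comp (center_hom w) (arm_hom (fun=> 1%:M) e 1%:M) = arm_hom E e (w *m E e).
Proof.
apply: modHomE => c; rewrite modHom_compE !arm_homE center_homE; congr pair.
  by rewrite /= mul0mx.
apply/matrixP => i j; rewrite [LHS]mxE [RHS]mxE /= [X in X * _]mxE mulmx1 -mulrA.
by case: eqP => [->|_]; rewrite ?mul0r // !mul1r [RHS]mxE big_ord1.
Qed.
End CenterHom.

Lemma rV1_scale (c : 'rV[k]_1) : c = c 0 0 *: 1%:M.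
Proof. by rewrite scalemx1 -mx11_scalar. Qed.

Section Coordinates.
Variables (N s : nat) (E : 'I_d -> 'M[k]_(N, s)).

(** A homomorphism sends the generator into the [lam e]-eigenspace of x, which is the arm e because
    the scalars are distinct. *)
Lemma arm_hom_coordinates e : hom_coordinates (arm_hom E e).
Proof.
have arm1 u j : (arm_hom E e u (1%:M : 'rV_1)).2 e j = u 0 j.
  by rewrite arm_homE mxE eqxx mul1r mul1mx.
split=> [a u v|u v uv|f].
- apply: modHomE => c; rewrite modHom_linE !arm_homE; congr pair.
    by rewrite /= scaler0 addr0.
  by apply/matrixP => i j; rewrite [LHS]mxE linearP /= !mxE mulrDr mulrCA.
- by apply/rowP => j; rewrite -!arm1 uv.
pose u := row e (f (1%:M : 'rV_1)).2; exists u; apply: modHomE => c.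
have fx : f (lam e *: (1%:M : 'rV_1)) = star_x (f (1%:M : 'rV_1)).
  have [fx _] := xy_hom_act f (1%:M : 'rV_1).
  by move: fx; rewrite scale_lfunE id_lfunE (linfunE (@star_x_linear _ _)).
rewrite [c]rV1_scale !linearZ /= arm_homE; congr (_ *: _).
move: fx; rewrite linearZ /= /u; case: (f _) => a b [/= fa fb]; congr pair.
  apply/eqP; move/eqP: fa; rewrite -subr_eq0 -scalerBl scaler_eq0 subr_eq0.
  by rewrite (negbTE (lam_neq0 e)).
apply/matrixP => i j; rewrite [RHS]mxE mul1mx [row _ _ _ _]mxE /=; have [->|ne_ie] := eqVneq i e.
  by rewrite mul1r.
move/matrixP: fb => /(_ i j); rewrite !mxE mul0r => /eqP.
rewrite -subr_eq0 -mulrBl mulf_eq0 subr_eq0 (inj_eq lam_inj) eq_sym (negbTE ne_ie).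
by move/eqP.
Qed.

Lemma star1_decomposition (u : star1) :
  u = (u.1, 0) + \sum_e arm_hom (fun=> 1%:M) e 1%:M ((u.2 e 0)%:M : 'rV_1) :> star1.
Proof.
case: u => u b /=.
have sum1 (F : 'I_d -> star1) : (\sum_e F e).1 = \sum_e (F e).1 by apply: (big_morph fst).
have sum2 (F : 'I_d -> star1) : (\sum_e F e).2 = \sum_e (F e).2 by apply: (big_morph snd).
apply: injective_projections => /=.
  by rewrite sum1 big1 ?addr0 // => e _; rewrite arm_homE.
rewrite sum2 add0r; apply/matrixP => e j; rewrite summxE (bigD1 e) //= big1 ?addr0.
  by rewrite arm_homE mxE eqxx mul1r mulmx1 (ord1 j) mxE.
by move=> e' /negbTE ne; rewrite arm_homE mxE eq_sym ne mul0r.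
Qed.

(** Commutation with x places the image w of the centre vector in the centre; commutation with y
    then forces the value [w *m E e] on arm e. *)
Lemma center_hom_coordinates : hom_coordinates (center_hom E).
Proof.
have center1 w : (center_hom E w (1%:M, 0)).1 = w by rewrite center_homE /= mul1mx.
split=> [a u v|u v uv|f].
- apply: modHomE => c; rewrite modHom_linE !center_homE; congr pair.
    by rewrite /= linearP.
  apply/matrixP => i j; rewrite [LHS]mxE mulmxDl -scalemxAl !mxE.
  by rewrite mulrDr mulrCA.
- by rewrite -[u]center1 uv center1.
have [fx fy] := xy_hom_act f ((1%:M, 0) : 'rV_1 * 'M_(d, 1)).
rewrite !(linfunE (@star_x_linear _ _)) in fx.
rewrite !(linfunE (@star_y_linear _ _ _)) in fy.
pose w := (f ((1%:M, 0) : 'rV_1 * 'M_(d, 1))).1.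
have f1 : f ((1%:M, 0) : 'rV_1 * 'M_(d, 1)) = (w, 0).
  rewrite /w; move: fx.
  have -> : @star_x 1 1 (1%:M, 0) = lam0 *: (1%:M, 0).
    by congr pair; apply/matrixP => i j; rewrite !mxE !mulr0.
  rewrite linearZ /=; case: (f _) => a b [/= fb]; apply: injective_projections => //=.
  apply/matrixP => i j; move/matrixP: fb => /(_ i j); rewrite !mxE => /eqP.
  rewrite -subr_eq0 -mulrBl mulf_eq0 subr_eq0 eq_sym (negbTE (lam_neq0 i)).
  by move/eqP.
have fe e : exists u, modHom_comp f (arm_hom (fun=> 1%:M) e 1%:M) = arm_hom E e u.
  by have [_ _] := arm_hom_coordinates e; apply.
pose U e := projT1 (cid (fe e)).
have UE e : modHom_comp f (arm_hom (fun=> 1%:M) e 1%:M) = arm_hom E e (U e).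
  exact: projT2 (cid (fe e)).
have f_arm e c : f (arm_hom (fun=> 1%:M) e 1%:M c) = arm_hom E e (U e) c.
  by rewrite -UE modHom_compE.
have pair_scale (v : 'rV[k]_1) : (v, 0) = v 0 0 *: (1%:M, 0) :> star1.
  by apply: injective_projections => /=; rewrite -?rV1_scale ?scaler0.
have sum2 (F : 'I_d -> star E) : (\sum_e F e).2 = \sum_e (F e).2 by apply: (big_morph snd).
have UwE e : U e = w *m E e.
  apply/rowP => j; move: fy.
  rewrite f1 [X in f X]star1_decomposition linearD linear_sum /= -/star1.
  have -> : ((0 : 'rV[k]_1), (0 : 'M[k]_(d, 1))) = 0 :> star1 by [].
  rewrite linear0 add0r; under eq_bigr => e' _ do rewrite f_arm arm_homE.
  move=> /(congr1 snd); rewrite sum2 => /matrixP/(_ e j).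
  rewrite summxE (bigD1 e) //= big1 => [|e' /negbTE ne]; last first.
    by rewrite mxE eq_sym ne mul0r.
  rewrite addr0 mxE eqxx mul1r [RHS]mxE.
  have -> : (star_y (fun=> 1%:M) (1%:M, 0)).2 e 0 = 1 :> k by rewrite mxE mulmx1 mxE.
  by rewrite mul1mx.
exists w; apply: modHomE => u; rewrite [u]star1_decomposition !linearD !linear_sum /=.
congr (_ + _); last by apply: eq_bigr => e _; rewrite f_arm UwE -center_hom_arm modHom_compE.
rewrite pair_scale !linearZ /= f1 center_homE; congr (_ *: (_, _)); first by rewrite mul1mx.
by apply/matrixP => e j; rewrite !mxE mul0r.
Qed.
End Coordinates.

Definition brick (B : algType k) (X : fdModule B) : Prop :=
  (exists x : X, x != 0) /\ forall f : modHom X X, exists c, f = c *: modHom_id X.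

Lemma modHom_scaleE (B : algType k) (M N : fdModule B) a (f : modHom M N) x :
  (a *: f) x = a *: f x.
Proof. by rewrite /= scale_lfunE. Qed.

Lemma simple_brick c : brick (simple c).
Proof.
split; first by exists (1%:M : 'rV_1); rewrite -scalemx1 scale1r oner_eq0.
move=> f; exists (f (1%:M : 'rV_1) 0 0); apply: modHomE => v.
rewrite modHom_scaleE modHom_idE [v]rV1_scale linearZ /=.
by rewrite scalerA mulrC -scalerA -rV1_scale.
Qed.

Lemma star1_brick : brick star1.
Proof.
split.
  exists ((1%:M, 0) : star1); apply: contraTneq isT => /(congr1 fst) /= /eqP.
  by rewrite -scalemx1 scale1r oner_eq0.
move=> f; have [_ _ /(_ f)[w ->]] := center_hom_coordinates (fun=> 1%:M : 'M[k]_1).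
exists (w 0 0); apply: modHomE => u; rewrite modHom_scaleE modHom_idE center_homE.
rewrite /center_fun; congr (_, _); rewrite [w]rV1_scale !mxE.
  by rewrite -scalemxAr mulmx1 eqxx mulr1.
apply/matrixP => i j; rewrite (ord1 j) mulmx1 !mxE eqxx mulr1.
by rewrite mulrC.
Qed.

(** * Top and socle of a star *)

Section Exactness.
Variables (N s : nat) (E : 'I_d -> 'M[k]_(N, s)).

Definition top_module : fdModule (free_algebra2 k) :=
  @xy_module k 'rV[k]_N (lam0 *: \1%VF) 0.

Definition socle_x (u : 'M[k]_(d, s)) : 'M[k]_(d, s) := \matrix_(e, j) (lam e * u e j).
Fact socle_x_linear : linear socle_x.
Proof. by move=> c u v; apply/matrixP => e j; rewrite !mxE mulrDr mulrCA. Qed.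
Definition socle_module : fdModule (free_algebra2 k) :=
  @xy_module k 'M[k]_(d, s) (linfun socle_x) 0.

Fact socle_incl_linear : linear (fun u : 'M[k]_(d, s) => ((0, u) : 'rV[k]_N * 'M[k]_(d, s))).
Proof. by move=> c u v; congr pair; rewrite /= scaler0 addr0. Qed.

(** With exactness of F this reduces the dimension of F M to the values of F on sums of simple
    modules. *)
Lemma star_exact : exists (f : modHom socle_module (star E)) (g : modHom (star E) top_module),
  short_exact f g.
Proof.
have [||f fE] := @xy_homE k 'M_(d, s) ('rV_N * 'M_(d, s))%type (linfun socle_x) 0
  (linfun (@star_x N s)) (linfun (star_y E)) (linfun (fun u : 'M[k]_(d, s) => ((0, u) : 'rV[k]_N * 'M[k]_(d, s)))).
- move=> u; rewrite !(linfunE socle_incl_linear) (linfunE socle_x_linear).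
  by rewrite (linfunE (@star_x_linear _ _)) /star_x /= scaler0.
- move=> u; rewrite !(linfunE socle_incl_linear) zero_lfunE.
  rewrite (linfunE (@star_y_linear _ _ _)); congr pair.
  by apply/matrixP => i j; rewrite [RHS]mxE /= mul0mx !mxE.
have fstE (u : 'rV[k]_N * 'M[k]_(d, s)) : (linfun fst : 'Hom('rV_N * 'M_(d, s), 'rV_N)%type) u = u.1.
  by rewrite lfunE.
have [||g gE] := @xy_homE k ('rV_N * 'M_(d, s))%type 'rV_N
  (linfun (@star_x N s)) (linfun (star_y E)) (lam0 *: \1%VF) 0 (linfun fst).
- by move=> u; rewrite !fstE (linfunE (@star_x_linear _ _)) scale_lfunE id_lfunE.
- by move=> u; rewrite !fstE (linfunE (@star_y_linear _ _ _)) zero_lfunE.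
have fE' u : f u = (0, u) by rewrite fE (linfunE socle_incl_linear).
have gE' u : g u = u.1 by rewrite gE fstE.
exists f, g; split.
- apply/eqP/lker0P => u v; rewrite !fE' => /(congr1 snd). exact.
- apply/vspaceP => u; rewrite memv_ker gE'; apply/memv_imgP/eqP => [[v _ ->]|u0].
    by rewrite fE'.
  by exists u.2; rewrite ?memvf // fE'; case: u u0 => ? ? /= ->.
apply/vspaceP => u; rewrite memvf; apply/memv_imgP.
by exists ((u, 0) : star E); rewrite ?memvf // gE'.
Qed.

Fact coeff_linear m n (i : 'I_m) (j : 'I_n) : linear (fun u : 'M[k]_(m, n) => (u i j)%:M : 'rV[k]_1).
Proof. by move=> c u v; apply/rowP => a; rewrite !mxE !ord1 !mulr1n. Qed.
Fact delta_linear m n (i : 'I_m) (j : 'I_n) :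
  linear (fun c : 'rV[k]_1 => c 0 0 *: delta_mx i j : 'M[k]_(m, n)).
Proof. by move=> a u v; rewrite !mxE scalerDl scalerA. Qed.

Lemma top_split : splits_into (fun _ : 'I_N => simple lam0) top_module.
Proof.
have ex_i j : exists g : modHom (simple lam0) top_module,
    g = linfun (fun c : 'rV[k]_1 => c 0 0 *: delta_mx 0 j : 'rV[k]_N) :> 'Hom('rV_1, 'rV_N).
  by apply: xy_homE => c; rewrite !(scale_lfunE, id_lfunE, zero_lfunE) ?linearZ ?linear0.
have ex_p j : exists g : modHom top_module (simple lam0),
    g = linfun (fun u : 'rV[k]_N => (u 0 j)%:M : 'rV[k]_1) :> 'Hom('rV_N, 'rV_1).
  by apply: xy_homE => c; rewrite !(scale_lfunE, id_lfunE, zero_lfunE) ?linearZ ?linear0.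
exists (fun j => projT1 (cid (ex_i j))), (fun j => projT1 (cid (ex_p j))) => u.
rewrite {1}[u]row_sum_delta; apply: eq_bigr => j _.
case: cid => p /= ->; case: cid => q /= ->.
by rewrite (linfunE (delta_linear _ _)) (linfunE (coeff_linear _ _)) mxE eqxx.
Qed.

Lemma socle_split : splits_into (fun p : 'I_d * 'I_s => simple (lam p.1)) socle_module.
Proof.
have ex_i (p : 'I_d * 'I_s) : exists g : modHom (simple (lam p.1)) socle_module,
    g = linfun (fun c : 'rV[k]_1 => c 0 0 *: delta_mx p.1 p.2 : 'M[k]_(d, s))
      :> 'Hom('rV_1, 'M_(d, s)).
  apply: xy_homE => c; rewrite !(scale_lfunE, id_lfunE, zero_lfunE) ?linear0 //.
  rewrite (linfunE socle_x_linear) !(linfunE (delta_linear _ _)).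
  apply/matrixP => i j; rewrite !mxE -mulrA; have [->|_] := eqVneq i p.1.
    by rewrite mulrCA.
  by rewrite !mulr0.
have ex_p (p : 'I_d * 'I_s) : exists g : modHom socle_module (simple (lam p.1)),
    g = linfun (fun u : 'M[k]_(d, s) => (u p.1 p.2)%:M : 'rV[k]_1) :> 'Hom('M_(d, s), 'rV_1).
  apply: xy_homE => c; rewrite !(scale_lfunE, id_lfunE, zero_lfunE) ?linear0 //.
  rewrite (linfunE socle_x_linear) !(linfunE (coeff_linear _ _)).
  by apply/rowP => a; rewrite !mxE !ord1 !mulr1n.
exists (fun j => projT1 (cid (ex_i j))), (fun j => projT1 (cid (ex_p j))) => u.
rewrite {1}[u]matrix_sum_delta pair_big; apply: eq_bigr => -[i j] _ /=.
case: cid => p /= ->; case: cid => q /= ->.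
by rewrite (linfunE (delta_linear _ _)) (linfunE (coeff_linear _ _)) mxE eqxx.
Qed.
End Exactness.

End Star.

(** * Controlled functors *)


(** In the closure of a finite field all nonzero elements are roots of unity, so the order of g can
    only be made large. The polynomial [q] vanishes at 0 and at all roots of unity of order at most
    n; a root of [q + 1] avoids them. *)
Lemma exists_distinct_powers (k : closedFieldType) n :
  exists g : k, {in [pred a | a < n]%N &, injective (GRing.exp g)}.
Proof.
pose q : {poly k} := 'X * \prod_(0 <= i < n) ('X^(i.+1) - 1).
have sz i : size ('X^(i.+1) - 1 : {poly k}) = i.+2.
  by rewrite size_polyDl size_polyXn // size_polyN size_poly1.
have q0 : \prod_(0 <= i < n) ('X^(i.+1) - 1) != 0 :> {poly k}.
  by rewrite prodf_seq_neq0; apply/allP => i _; rewrite -size_poly_gt0 sz.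
have /closed_rootP[g] : size (q + 1) != 1%N.
  have szq : (1 < size q)%N by rewrite /q mulrC size_mulX // ltnS size_poly_gt0.
  by rewrite size_polyDl ?size_poly1 // gtn_eqF.
rewrite rootE hornerD hornerC hornerM hornerX horner_prod => g_root.
have g0 : g != 0.
  by apply: contraTneq g_root => ->; rewrite mul0r add0r oner_eq0.
have g1 i : (i < n)%N -> g ^+ i.+1 != 1.
  move=> lt_in; apply: contraTneq g_root => gi.
  rewrite (bigD1_seq i) ?mem_index_iota ?iota_uniq //=.
  by rewrite hornerD hornerN hornerC hornerXn gi subrr mul0r mulr0 add0r oner_eq0.
exists g => i j; rewrite !inE.
wlog ij : i j / (i <= j)%N.
  by move=> IH i_n j_n; case/orP: (leq_total i j) => le /[dup] e;
     [exact: IH | move/esym/IH => ->].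
move=> _ lt_jn; rewrite -{1}(subnKC ij) exprD -{1}[g ^+ i]mulr1.
move/(mulfI (expf_neq0 _ g0)); case: (posnP (j - i)) => [/eqP|].
  by rewrite subn_eq0 => ji _; apply/eqP; rewrite eqn_leq ij.
move=> gt0 /esym/eqP; case: (j - i)%N gt0 (leq_subr i j) => // m _ le_m.
by rewrite (negbTE (g1 _ _)) // (leq_trans le_m) // ltnW.
Qed.

Lemma lfun_eigenvector (k : closedFieldType) (V : vectType k) (f : 'End(V)) :
  (exists v : V, v != 0) -> exists c (v : V), v != 0 /\ f v = c *: v.
Proof.
case=> v0 v0_neq0; pose e := vbasis {:V}.
have dimV : (0 < \dim {:V})%N.
  rewrite lt0n dimv_eq0; apply: contraNneq v0_neq0 => V0.
  by rewrite -memv0 -V0 memvf.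
pose A := passmx.mxof e e f.
have /closed_rootP[c] : size (char_poly A) != 1%N.
  by rewrite size_char_poly eqSS -lt0n.
rewrite -eigenvalue_root_char => cA.
have : passmx.leigenspace f c != 0%VS.
  rewrite (passmx.leigenspaceE (vbasisP _)) passmx.vsof_eq0 //.
  exact: vbasisP.
rewrite -vpick0; set v := vpick _ => v_neq0; exists c, v; split=> //.
have := memv_pick (passmx.leigenspace f c); rewrite memv_ker -/v.
by rewrite add_lfunE opp_lfunE scale_lfunE id_lfunE subr_eq0 => /eqP.
Qed.

Lemma short_exact_dim (k : fieldType) (B : algType k) (M N P : fdModule B)
    (f : modHom M N) (g : modHom N P) :
  short_exact f g -> fd_dim N = (fd_dim M + fd_dim P)%N.
Proof.
case=> f0 fg gP; rewrite /fd_dim -(limg_ker_dim g {:N}) gP capfv -fg.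
by rewrite limg_dim_eq // f0 capv0.
Qed.

Section Functor.
Variables (k : fieldType) (B B' : algType k) (F : modFunctor B B').

Lemma fmap0 M N : fmap F (0 : modHom M N) = 0.
Proof. by apply: (addrI (fmap F 0)); rewrite -fmap_add !addr0. Qed.

Lemma fmap_sum (I : Type) (r : seq I) M N (f : I -> modHom M N) :
  fmap F (\sum_(i <- r) f i) = \sum_(i <- r) fmap F (f i).
Proof. by apply: big_morph; [exact: fmap_add | exact: fmap0]. Qed.

Lemma modHom_sumE (C : algType k) (M N : fdModule C) (I : Type) (r : seq I) (f : I -> modHom M N) x :
  (\sum_(i <- r) f i) x = \sum_(i <- r) f i x.
Proof.
elim: r => [|i r IHr]; first by rewrite !big_nil /= zero_lfunE.
by rewrite !big_cons /= add_lfunE IHr.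
Qed.

(** F carries the decomposition of the identity of [M] to one of the identity of F M, so the images
    of the F(X_i) span F M. *)
Lemma dim_fobj_split (I : finType) (X : I -> fdModule B) M :
  splits_into X M -> (fd_dim (F M) <= \sum_i fd_dim (F (X i)))%N.
Proof.
case=> i [q iq].
have idM : modHom_id M = \sum_p modHom_comp (i p) (q p).
  apply: modHomE => x; rewrite modHom_idE modHom_sumE {1}[x]iq.
  by apply: eq_bigr => p _; rewrite modHom_compE.
have /dimvS : ({:F M} <= \sum_p limg (fmap F (i p)))%VS.
  apply/subvP => x _; rewrite -[x]modHom_idE -fmap_id idM fmap_sum modHom_sumE.
  apply: memv_sumr => p _; rewrite fmap_comp modHom_compE memv_img ?memvf //.
move/leq_trans; apply; apply: leq_trans (dimv_leq_sum _ _ _) _.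
by apply: leq_sum => p _; rewrite /fd_dim -(limg_ker_dim (fmap F (i p)) fullv) leq_addl.
Qed.
End Functor.

Lemma brick_scale_eq0 (k : fieldType) (B : algType k) (X : fdModule B) c :
  brick X -> c *: modHom_id X = 0 -> c = 0.
Proof.
case=> -[x x0] _ cX; apply/eqP; have : c *: x == 0.
  by rewrite -[x]modHom_idE -modHom_scaleE cX zero_lfunE.
by rewrite scaler_eq0 (negbTE x0) orbF.
Qed.

Section Controlled.
Variables (k : closedFieldType) (A : falgType k) (C : fdModule A).
Variable F : modFunctor (free_algebra2 k) A.
Hypothesis F_faithful : faithful F.
Hypothesis F_controlled : forall X Y : fdModule (free_algebra2 k),
  [/\ forall h : modHom (F X) (F Y),
        exists (f : modHom X Y) (g : modHom (F X) (F Y)),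
        factors_through (add_closure C) g /\ h = fmap F f + g,
      forall f : modHom X Y, factors_through (add_closure C) (fmap F f) -> fmap F f = 0 &
      forall g : modHom (F X) (F Y), factors_through (add_closure C) g -> in_radical g].

Let K X Y : {vspace 'Hom(F X, F Y)} := through C (F X) (F Y).

Lemma fmap_through X Y (f : modHom X Y) : (fmap F f : 'Hom(F X, F Y)) \in K X Y -> f = 0.
Proof.
have [_ Fz _] := F_controlled X Y => /factors_through_add/Fz f0.
by apply: F_faithful; rewrite f0 fmap0.
Qed.

Lemma fmap_decomposition X Y (h : modHom (F X) (F Y)) :
  exists f : modHom X Y, (h - fmap F f : 'Hom(F X, F Y)) \in K X Y.
Proof.
have [Fd _ _] := F_controlled X Y; have [f [g [Cg ->]]] := Fd h.
by exists f; rewrite /= addrC addKr; apply/factors_through_add.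
Qed.

Lemma through_compr X Y (f : modHom X Y) (h : modHom (F X) (F X)) :
  (h : 'Hom(F X, F X)) \in K X X -> (fmap F f \o h)%VF \in K X Y.
Proof.
move=> /factors_through_add[Z [g [h' [CZ ->]]]].
apply/(@factors_through_add _ _ C _ _ (modHom_comp (fmap F f) (modHom_comp h' g))).
exists Z, g, (modHom_comp (fmap F f) h'); split=> //.
by apply: modHomE => x; rewrite !modHom_compE.
Qed.

Lemma through_compl (X' X Y : fdModule (free_algebra2 k)) (f : modHom X' X) (h : modHom (F X) (F Y)) :
  (h : 'Hom(F X, F Y)) \in K X Y -> (h \o fmap F f)%VF \in K X' Y.
Proof.
move=> /factors_through_add[Z [g [h' [CZ ->]]]].
apply/(@factors_through_add _ _ C _ _ (modHom_comp (modHom_comp h' g) (fmap F f))).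
exists Z, (modHom_comp g (fmap F f)), h'; split=> //.
by apply: modHomE => x; rewrite !modHom_compE.
Qed.

(** * Transfer of linear independence along F *)

Section Brick.
Variables (X : fdModule (free_algebra2 k)).
Hypothesis X_brick : brick X.

Lemma fobj_neq0 : exists v : F X, v != 0.
Proof.
apply: contrapT => no_v; have [[x /eqP x0] _] := X_brick; apply: x0.
have : modHom_id X = 0.
  apply: F_faithful; rewrite fmap_id fmap0; apply: modHomE => v.
  rewrite modHom_idE zero_lfunE; apply/eqP; apply: contrapT => v0.
  by apply: no_v; exists v; apply/negP.
by move=> X0; rewrite -[x]modHom_idE X0 zero_lfunE.
Qed.

(** Otherwise the identity of F X lies in K, hence in the radical, and 1 - 1 = 0 is invertible on
    the nonzero module F X. *)
Lemma scale_through_eq0 a :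
  (a *: modHom_id (F X) : 'Hom(F X, F X)) \in K X X -> a = 0.
Proof.
move=> aK; apply/eqP; apply: contrapT => /negP a0.
have : (modHom_id (F X) : 'Hom(F X, F X)) \in K X X.
  by have := memvZ a^-1 aK; rewrite scalerK.
move=> /factors_through_add; have [_ _ rad] := F_controlled X X => /rad.
move=> /(_ (modHom_id _))[g [/(congr1 (fun f : modHom _ _ => f : 'Hom(_, _)))/lfunP gE _]].
have [v /eqP] := fobj_neq0; apply; have := gE v.
by rewrite modHom_compE modHom_idE /= add_lfunE opp_lfunE comp_lfunE !id_lfunE subrr linear0.
Qed.

(** Together with [scale_target] this replaces k-linearity of F: scalars of F X and of the brick X
    correspond to each other modulo K. *)
Lemma scale_source a : exists c,
  (a *: modHom_id (F X) - fmap F (c *: modHom_id X) : 'Hom(F X, F X)) \in K X X.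
Proof.
have [f fK] := fmap_decomposition (a *: modHom_id (F X)).
by have [_ /(_ f)[c fE]] := X_brick; exists c; rewrite -fE.
Qed.

(* F need not be k-linear; that every scalar of End X becomes a scalar of
   End (F X) modulo K uses an eigenvalue, hence that k is algebraically closed. *)
Lemma scale_target c : exists a,
  (fmap F (c *: modHom_id X) - a *: modHom_id (F X) : 'Hom(F X, F X)) \in K X X.
Proof.
have [a [v [v0 va]]] := lfun_eigenvector (fmap F (c *: modHom_id X) : 'End(F X)) fobj_neq0.
exists a; pose h := fmap F (c *: modHom_id X) - a *: modHom_id (F X).
have [Fd _ rad] := F_controlled X X; have [f [g [Cg hE]]] := Fd h.
have [_ /(_ f)[d fE]] := X_brick.
have hv : h v = 0 by rewrite /h /= add_lfunE opp_lfunE scale_lfunE id_lfunE va subrr.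
have [d0|d_neq0] := eqVneq d 0.
  have hg : h = g by rewrite hE fE d0 scale0r fmap0 add0r.
  suff : (h : 'Hom(F X, F X)) \in K X X by [].
  by rewrite hg; apply/factors_through_add.
(* For d nonzero, F(d^-1) h = 1 + F(d^-1) g is invertible because g is radical, yet h kills the
   eigenvector v. *)
have [u [/(congr1 (fun f : modHom _ _ => f : 'Hom(_, _)))/lfunP uE _]] :=
  rad g Cg (- fmap F (d^-1 *: modHom_id X)).
case/eqP: v0; have := uE v; rewrite modHom_compE modHom_idE => <-.
rewrite [X in u X](_ : _ = 0) ?linear0 //.
have dd : modHom_comp (fmap F (d^-1 *: modHom_id X)) (fmap F f) = modHom_id (F X).
  rewrite -fmap_comp fE -[RHS]fmap_id; congr fmap; apply: modHomE => x.
  by rewrite modHom_compE !modHom_scaleE !modHom_idE scalerA mulVf // scale1r.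
have /(congr1 (fmap F (d^-1 *: modHom_id X))) := hv.
rewrite hE linear0 /= add_lfunE linearD /= -[X in X + _ = _]modHom_compE dd => <-.
by rewrite /= add_lfunE opp_lfunE comp_lfunE opp_lfunE opprK.
Qed.

Variables (M : fdModule (free_algebra2 k)) (n : nat) (theta : 'rV[k]_n -> modHom X M).
Hypothesis thetaP : hom_coordinates theta.

Lemma theta_sum r (c : 'I_r -> k) (w : 'I_r -> 'rV[k]_n) :
  theta (\sum_p c p *: w p) = \sum_p c p *: theta (w p).
Proof.
have [tlin _ _] := thetaP.
have t0 : theta 0 = 0.
  by have := tlin (-1) 0 0; rewrite scaler0 addr0 scaleN1r addNr.
elim/big_rec2: _ => // p y z _ <-; exact: tlin.
Qed.

(** Scalars act on Hom(X, M) by composition with scalars of X, and K is stable under composition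
    with F f. *)
Lemma scale_fmap a c (f : modHom X M) :
  (a *: modHom_id (F X) - fmap F (c *: modHom_id X) : 'Hom(F X, F X)) \in K X X ->
  a *: (fmap F f : 'Hom(F X, F M)) - fmap F (c *: f) \in K X M.
Proof.
move=> acK; pose h := a *: modHom_id (F X) - fmap F (c *: modHom_id X).
suff -> : a *: (fmap F f : 'Hom(F X, F M)) - fmap F (c *: f) = (fmap F f \o h)%VF.
  exact: through_compr.
apply/lfunP => x.
have -> : c *: f = modHom_comp f (c *: modHom_id X).
  by apply: modHomE => y; rewrite modHom_compE !modHom_scaleE modHom_idE linearZ.
rewrite fmap_comp /= !(add_lfunE, opp_lfunE, scale_lfunE, comp_lfunE, id_lfunE).
by rewrite linearB linearZ.
Qed.

Lemma scale_fmap_sum r (a c : 'I_r -> k) (f : 'I_r -> modHom X M) :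
  (forall p, (a p *: modHom_id (F X) - fmap F (c p *: modHom_id X) : 'Hom(F X, F X))
     \in K X X) ->
  \sum_p a p *: (fmap F (f p) : 'Hom(F X, F M)) - fmap F (\sum_p c p *: f p) \in K X M.
Proof.
move=> acK.
rewrite [X in _ - X](_ : _ = \sum_p (fmap F (c p *: f p) : 'Hom(F X, F M))); last first.
  by apply/lfunP => x; rewrite fmap_sum modHom_sumE sum_lfunE.
by rewrite -sumrB memv_suml // => p _; apply: scale_fmap.
Qed.

Lemma row_combination_eq0 r (R : 'M[k]_(r, n)) (c : 'I_r -> k) :
  row_free R -> \sum_p c p *: row p R = 0 -> forall p, c p = 0.
Proof.
move=> Rfree cR; have : (\row_p c p) *m R = 0.
  by rewrite mulmx_sum_row -[RHS]cR; apply: eq_bigr => p _; rewrite mxE.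
move/(congr1 (mulmx^~ (pinvmx R))); rewrite -mulmxA mulmxVp // mul0mx mulmx1.
by move=> c0 p; have /rowP/(_ p) := c0; rewrite !mxE.
Qed.

(** A relation modulo K between the [tau p] is translated by [scale_source] into a relation between
    the rows of [R]; its coefficients vanish, and then so do the original ones by
    [scale_through_eq0]. *)
Lemma leq_row_free_dim r (R : 'M[k]_(r, n)) (T : {vspace 'Hom(F X, F M)}) tau :
    row_free R -> (forall p : 'I_r, tau p \in T) ->
    (forall p, tau p - fmap F (theta (row p R)) \in K X M) ->
  (r <= \dim (T :\: K X M))%N.
Proof.
move=> Rfree tauT tauK; apply: (leq_dim_diffv tauT) => c ctauK.
pose s p := projT1 (cid (scale_source (c p))).
have sP p : (c p *: modHom_id (F X) - fmap F (s p *: modHom_id X) : 'Hom(F X, F X)) \in K X X.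
  exact: projT2 (cid (scale_source (c p))).
have : (fmap F (theta (\sum_p s p *: row p R)) : 'Hom(F X, F M)) \in K X M.
  rewrite theta_sum -memvN.
  have := scale_fmap_sum (fun p => theta (row p R)) sP; set u := \sum_p _ => uK.
  have uK' : u \in K X M.
    rewrite -[u](subKr (\sum_p c p *: tau p)) memvB // /u -sumrB memv_suml // => p _.
    by rewrite -scalerBr memvZ.
  by have := memvB uK uK'; rewrite addrC addKr.
move=> /fmap_through t0 p.
have s0 : s p = 0.
  move: p; apply: (row_combination_eq0 Rfree).
  have [_ tinj _] := thetaP; apply: tinj; rewrite t0.
  by have := theta_sum (fun _ : 'I_0 => 0) (fun _ => 0); rewrite !big_ord0.
apply: scale_through_eq0; have := sP p; rewrite s0 scale0r fmap0.
by rewrite subr0.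
Qed.

(** Converse transfer: basis vectors of [D] are images under F modulo K, and a relation between
    their coordinate rows becomes, by [scale_target], a relation between the basis vectors. *)
Lemma row_free_lift (D : {vspace 'Hom(F X, F M)}) :
    (D <= homs (F X) (F M))%VS -> (D :&: K X M = 0)%VS ->
  exists R : 'M[k]_(\dim D, n), row_free R /\
    forall p : 'I_(\dim D), (vbasis D)`_p - fmap F (theta (row p R)) \in K X M.
Proof.
move=> Dhoms DK.
have bD (p : 'I_(\dim D)) : (vbasis D)`_p \in D.
  by apply/vbasis_mem/mem_nth; rewrite size_tuple.
have ex (p : 'I_(\dim D)) : exists w, (vbasis D)`_p - fmap F (theta w) \in K X M.
  have /homs_modHom[h hE] := subvP Dhoms _ (bD p).
  have [f fK] := fmap_decomposition h; have [_ _ /(_ f)[w fw]] := thetaP.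
  by exists w; rewrite -hE -fw.
pose R := \matrix_(p < \dim D) projT1 (cid (ex p)).
have RP (p : 'I_(\dim D)) : (vbasis D)`_p - fmap F (theta (row p R)) \in K X M.
  by rewrite rowK; exact: projT2 (cid (ex p)).
exists R; split=> //; apply: inj_row_free => v vR.
pose a (p : 'I_(\dim D)) := projT1 (cid (scale_target (v 0 p))).
have aP (p : 'I_(\dim D)) : (a p *: modHom_id (F X) - fmap F (v 0 p *: modHom_id X) : 'Hom(F X, F X)) \in K X X.
  by rewrite -memvN opprB; exact: projT2 (cid (scale_target (v 0 p))).
have a0 : forall p, a p = 0.
  have /freeP free_b := basis_free (vbasisP D); apply: (free_b a).
  apply/eqP; rewrite -memv0 -DK memv_cap memv_suml => [|p _]; last by rewrite memvZ.
  have := scale_fmap_sum (fun p => theta (row p R)) aP.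
  rewrite -theta_sum -mulmx_sum_row vR; set u := \sum_p _ => uK.
  have t0 : theta 0 = 0.
    by have := theta_sum (fun _ : 'I_0 => 0) (fun _ => 0); rewrite !big_ord0.
  rewrite t0 fmap0 subr0 in uK.
  rewrite -[X in X \in _](subrK u) memvD // -sumrB memv_suml // => p _.
  by rewrite -scalerBr memvZ.
apply/rowP => p; rewrite mxE; have := aP p; rewrite a0 scale0r sub0r memvN.
by move/fmap_through/(brick_scale_eq0 X_brick).
Qed.
End Brick.
End Controlled.

(** * Expansion of the parts of a star *)


(** From 3r <= s follows 3(s - r + 1) > 2s, so the design bound limits the total rank loss over the
    8 arms to 3r out of 8r. *)
Lemma expansion_of_design (k : fieldType) (g : k) s r (R : 'M[k]_(r, 2 * s)) :
    {in [pred a | a < 8 * s]%N &, injective (GRing.exp g)} ->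
    row_free R -> (3 * r <= s)%N ->
  (5 * r <= \sum_(e < 8) \rank (R *m eval_arm g (2 * s) s e))%N.
Proof.
move=> g_inj Rfree r3s.
have rs : (r <= s)%N by lia.
have := @subspace_design k g (2 * s) 8 s _ r R Rfree rs.
rewrite (maxn_idPr _); last by lia.
move=> /(_ g_inj); set S := (\sum_e _)%N => le_S.
have S3 : (S <= 3 * r)%N by nia.
have : (\sum_(e < 8) r <= S + \sum_(e < 8) \rank (R *m eval_arm g (2 * s) s e))%N.
  by rewrite /S -big_split /=; apply: leq_sum => e _; lia.
rewrite sum_nat_const card_ord; lia.
Qed.

Section Final.
Variables (k : closedFieldType) (A : falgType k) (C : fdModule A).
Variable F : modFunctor (free_algebra2 k) A.
Hypothesis F_faithful : faithful F.
Hypothesis F_exact : exact_functor F.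
Hypothesis F_controlled : forall X Y : fdModule (free_algebra2 k),
  [/\ forall h : modHom (F X) (F Y),
        exists (f : modHom X Y) (g : modHom (F X) (F Y)),
        factors_through (add_closure C) g /\ h = fmap F f + g,
      forall f : modHom X Y, factors_through (add_closure C) (fmap F f) -> fmap F f = 0 &
      forall g : modHom (F X) (F Y), factors_through (add_closure C) g -> in_radical g].

Section Star.
Variables (d : nat) (lam0 : k) (lam : 'I_d -> k).
Hypothesis lam_neq0 : forall e, lam e != lam0.
Hypothesis lam_inj : injective lam.
Variables (N s : nat) (E : 'I_d -> 'M[k]_(N, s)).
Let M := star lam0 lam E.
Let P1 := star1 lam0 lam.
Let S e := simple (lam e).

(** The coordinate maps from P to M stay independent modulo K after F. The final count uses a lower
    bound at the centre and, in [leq_dim_arm], an upper bound at the arms. *)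
Lemma leq_center_dim :
  (N <= \dim (homs (F P1) (F M)) - \dim (through C (F P1) (F M)))%N.
Proof.
set K := through _ _ _; set H := homs _ _.
have -> : (\dim H - \dim K = \dim (H :\: K))%N.
  by rewrite -(dimv_cap_compl H K) (capv_idPr (through_homs _ _ _)) addKn.
apply: (leq_row_free_dim F_faithful F_controlled (star1_brick lam_neq0 lam_inj)
  (center_hom_coordinates lam_neq0 lam_inj E) (R := 1%:M)
  (tau := fun p => fmap F (center_hom lam0 lam E (row p 1%:M)))).
- by rewrite row_free_unit unitmx1.
- by move=> p; apply: modHom_homs.
by move=> p; rewrite subrr mem0v.
Qed.

Lemma leq_dim_arm e :
  (\dim (homs (F (S e)) (F M)) - \dim (through C (F (S e)) (F M)) <= s)%N.
Proof.
set K := through _ _ _; set H := homs _ _.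
have -> : (\dim H - \dim K = \dim (H :\: K))%N.
  by rewrite -(dimv_cap_compl H K) (capv_idPr (through_homs _ _ _)) addKn.
have [|R [/eqP Rfree _]] := row_free_lift F_faithful F_controlled (simple_brick (lam e))
  (arm_hom_coordinates lam_neq0 lam_inj E e) (D := (H :\: K)%VS) (diffvSl _ _).
  exact: capv_diff.
by rewrite -Rfree rank_leq_col.
Qed.

(** F M is an extension of F of the top by F of the socle, both sums of simples; the coefficients of
    N and s depend only on F and the scalars. *)
Lemma dim_fobj_star : (fd_dim (F M) <= N * fd_dim (F (simple lam0)) +
  s * \sum_e fd_dim (F (S e)))%N.
Proof.
have [f [g fg]] := star_exact lam0 lam E.
rewrite (short_exact_dim (F_exact fg)) addnC; apply: leq_add.
  apply: leq_trans (dim_fobj_split F (top_split lam0 N)) _.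
  by rewrite sum_nat_const card_ord.
apply: leq_trans (dim_fobj_split F (socle_split lam s)) _.
rewrite -(pair_big_dep predT (fun=> predT) (fun e _ => fd_dim (F (S e)))) /=.
by rewrite big_distrr /=; apply: leq_sum => e _; rewrite sum_nat_const card_ord.
Qed.

Section Part.
Variables (t : nat) (Q : 'I_t -> fdModule A) (J : forall i, modHom (Q i) (F M)).

(** [R] spans the part of the centre covered by Q_i. Composing a map F P -> Q_i with F of the
    inclusion of S_e in P stays in Q_i and applies the e-th arrow to the coordinate, so Q_i also
    covers the image of this subspace in arm e. *)
Lemma part_expansion i :
  exists R : 'M[k]_(\dim (part J (F P1) i :\: through C (F P1) (F M)), N),
    row_free R /\ forall e, (\rank (R *m E e) <=
      \dim (part J (F (S e)) i :\: through C (F (S e)) (F M)))%N.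
Proof.
set K1 := through C (F P1) _; set D := (_ :\: K1)%VS.
have Dpart : (D <= part J (F P1) i)%VS by apply: diffvSl.
have [||R [Rfree RP]] := row_free_lift F_faithful F_controlled (star1_brick lam_neq0 lam_inj)
  (center_hom_coordinates lam_neq0 lam_inj E) (D := D).
- exact: subv_trans Dpart (part_homs _ _ _).
- exact: capv_diff.
(* [maxrankfun] selects independent rows of [R *m E e], as many as its rank. *)
exists R; split=> // e; set f := maxrankfun (R *m E e).
pose phi := arm_hom lam0 lam (fun=> 1%:M) e (1%:M : 'M[k]_1).
apply: (leq_row_free_dim F_faithful F_controlled (simple_brick (lam e))
  (arm_hom_coordinates lam_neq0 lam_inj E e) (R := rowsub f (R *m E e))
  (tau := fun q => ((vbasis D)`_(f q) \o fmap F phi)%VF)).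
- exact: maxrowsub_free.
- move=> q; have : (vbasis D)`_(f q) \in part J (F P1) i.
    by apply: (subvP Dpart); apply/vbasis_mem/mem_nth; rewrite size_tuple.
  case/memv_imgP => _ /homs_modHom[h <-] ->; rewrite postcompE -comp_lfunA -postcompE.
  by rewrite memv_img // (modHom_homs (modHom_comp h (fmap F phi))).
move=> q; rewrite row_rowsub row_mul -center_hom_arm fmap_comp.
have bK := RP (f q).
have /homs_modHom[h hE] := subvP (through_homs _ _ _) _ bK.
have := @through_compl _ _ C F (S e) P1 M phi h; rewrite hE => /(_ bK).
by rewrite comp_lfunDl comp_lfunNl.
Qed.
End Part.
End Star.
End Final.



Lemma dim_part (k : fieldType) (B : algType k) (Y X : fdModule B) t (Q : 'I_t -> fdModule B)
    (J : forall i, modHom (Q i) Y) i :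
  (\dim (part J X i) <= fd_dim X * fd_dim (Q i))%N.
Proof.
apply: leq_trans (_ : \dim (homs X (Q i)) <= _)%N.
  by rewrite -(limg_ker_dim (postcomp X (J i)) (homs X (Q i))) leq_addl.
by apply: leq_trans (dimvS (subvf _)) _; rewrite /fd_dim !dimvf.
Qed.

Theorem corollary30 (R : realType) (k : closedFieldType) (A : falgType k) :
  finitely_controlled_wild A -> ~ amenable_type A R.
Proof.
case=> C [_ _ [F [F_faithful F_exact F_controlled]]] amenable.
(* Nine distinct scalars: one for each of the 8 arms and one for the centre. *)
have [g0 g0_inj] := exists_distinct_powers k 9.
pose lam0 : k := g0 ^+ 8; pose lam (e : 'I_8) : k := g0 ^+ e.
have lam_neq0 e : lam e != lam0.
  apply/eqP => /g0_inj; rewrite !inE => /(_ (ltnW (ltn_ord e)) isT) e8.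
  by have := ltn_ord e; rewrite e8.
have lam_inj : injective lam.
  by move=> e e' /g0_inj; rewrite !inE => /(_ (ltnW (ltn_ord e)) (ltnW (ltn_ord e')))/val_inj.
pose P1 := star1 lam0 lam; pose S e := simple (lam e).
(* These constants are fixed before [s]: dim F M will be at most 2sc, and [D] collects the errors
   per unit of codimension u, the one at the centre with weight 5. The choice K > c D makes u
   vanish. *)
pose b := fd_dim (F P1).
pose c := (fd_dim (F (simple lam0)) + \sum_e fd_dim (F (S e)))%N.
pose D := (5 * b + \sum_e \dim (homs (F (S e)) C) * fd_dim C)%N.
pose K := (c * D).+1.
have [L [L_gt0 HL]] := amenable (K%:R^-1) ltac:(by rewrite invr_gt0 ltr0n).
have [l leL] : exists l : nat, L <= l%:R.
  by exists (Num.bound L); exact: ltW (archi_boundP (ltW L_gt0)).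
(* A part of dimension at most l covers at most b l dimensions of the centre, a third of [s] at
   most. The successor makes [s] positive, which the final contradiction needs. *)
pose s := (3 * (b * l)).+1.
have [g g_inj] := exists_distinct_powers k (8 * s).
pose E (e : 'I_8) := eval_arm g (2 * s) s e.
pose M := star lam0 lam E.
have [U [stableU [dimU [t [Q [Q_le decU]]]]]] := HL (F M) I.
have [J [P [JP J_indep]]] := submodule_decomposition decU.
set u := (fd_dim (F M) - \dim U)%N.
have le_K : (K * u <= fd_dim (F M))%N.
  (* The inequality dim U >= (1 - 1/K) dim F M with denominators cleared, where K - 1 = c D. *)
  have: (c * D * fd_dim (F M) <= K * \dim U)%N.
    have K0 : (K%:R : R) != 0 by rewrite pnatr_eq0.
    move: dimU; have -> : fd_dim (submodule stableU) = \dim U by rewrite /fd_dim !dimvf.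
    rewrite -(ler_pM2l (x := K%:R)) ?ltr0n // mulrA mulrBr mulr1 divff //.
    by rewrite /K -natr1 addrK -!natrM natr1 -natrM ler_nat.
  move=> le_U; rewrite /u mulnBr leq_subLR {1}/K mulSn addnC.
  by rewrite leq_add2r.
have le_FM : (fd_dim (F M) <= 2 * s * c)%N.
  apply: leq_trans (dim_fobj_star F_exact lam0 lam E) _.
  by rewrite /c mulnDr leq_add2l leq_mul2r leq_pmull ?orbT.
have le_center : (2 * s <= \sum_i \dim (part J (F P1) i :\: through C (F P1) (F M)) + b * u)%N.
  apply: leq_trans (leq_center_dim F_faithful F_controlled lam_neq0 lam_inj E) _.
  exact: (dim_homs_through JP C (F P1)).
have le_arm e : (\sum_i \dim (part J (F (S e)) i :\: through C (F (S e)) (F M)) <=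
    s + \dim (homs (F (S e)) C) * fd_dim C * u)%N.
  have := leq_dim_arm F_faithful F_controlled lam_neq0 lam_inj E e.
  rewrite leq_subLR => le_s; rewrite -(leq_add2r (\dim (through C (F (S e)) (F M)))).
  apply: leq_trans (sum_dim_part JP J_indep C (F (S e))) _.
  by rewrite -/u mulnA addnAC leq_add2r addnC.
have le_part i : (5 * \dim (part J (F P1) i :\: through C (F P1) (F M)) <=
    \sum_e \dim (part J (F (S e)) i :\: through C (F (S e)) (F M)))%N.
  have [W [Wfree rankW]] := part_expansion F_faithful F_controlled lam_neq0 lam_inj J i.
  apply: leq_trans (expansion_of_design g_inj Wfree _) _.
    apply: leq_trans (_ : 3 * (b * l) <= s)%N; last exact: leqnSn.
    rewrite leq_mul2l /=; apply: leq_trans (dimvS (diffvSl _ _)) _.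
    apply: leq_trans (dim_part _ _ _) _; rewrite leq_mul2l; apply/orP; right.
    by rewrite -(ler_nat R) (le_trans (Q_le i)).
  by apply: leq_sum => e _; apply: rankW.
have le_sum : (5 * \sum_i \dim (part J (F P1) i :\: through C (F P1) (F M)) <=
    8 * s + (\sum_e \dim (homs (F (S e)) C) * fd_dim C) * u)%N.
  rewrite big_distrr /=; apply: leq_trans (leq_sum _ (fun i _ => le_part i)) _.
  rewrite exchange_big /=; apply: leq_trans (leq_sum _ (fun e _ => le_arm e)) _.
  by rewrite big_split /= sum_nat_const card_ord big_distrl.
(* Five times the centre estimate gives 10 s <= 5 b u plus the left side of [le_sum], which is at
   most 8 s plus the arm errors; the difference is 2 s <= D u. *)
have s_le : (2 * s <= D * u)%N by rewrite /D; lia.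
(* K u <= dim F M <= 2 s c <= c D u = (K - 1) u. *)
have u0 : u = 0%N.
  have : (K * u <= c * D * u)%N.
    by apply: leq_trans le_K (leq_trans le_FM _); rewrite mulnC -mulnA leq_mul2l s_le orbT.
  rewrite /K; lia.
by move: s_le; rewrite u0 muln0.
Qed.
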